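(* Let $(\omega_n)_{n\ge 1}$ and $(b_n)_{n\ge 1}$ be real sequences with $\sum_{n=1}^\infty b_n^2<\infty$, and assume that $b_n\neq 0$ and $\omega_n>0$ for all $n=1,2,\dots$. Suppose that $$\sum_{\substack{i,j=1\\ i\neq j}}^\infty \frac{1}{(\omega_i-\omega_j)^2}<\infty$$ (in particular, $\omega_i\ne\omega_j$ for $i\neq j$, so that all terms are defined). Then there exists $\tau>0$ such that, provided that the damping coefficient $\kappa>0$ is small enough (i.e. there exists $\kappa_0>0$ such that for every $\kappa\in(0,\kappa_0)$), the control system $$\dot x = Ax+Bu,\quad x\in\ell^2,\ u\in\mathbb{R},$$ with $A={\rm diag}(A_0,A_1,A_2,\dots)$, $$A_0=\begin{pmatrix}0&1\\0&0\end{pmatrix},\qquad A_n=\begin{pmatrix}0&\omega_n\\-\omega_n&-2\kappa\end{pmatrix}\ (n\ge 1),\qquad B=(0,1,0,b_1,0,b_2,\dots)'\in\ell^2,$$ is approximately controllable in time $\tau$.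
   Context: $\ell^2$ is the real Hilbert space of square-summable sequences $x=(x_1,x_2,\dots)'$ with norm $\|x\|_{\ell^2}=\left(\sum_{n=1}^\infty x_n^2\right)^{1/2}$; the prime denotes transpose. Coordinates are grouped into consecutive pairs, written $x=(\xi_0,\eta_0,\xi_1,\eta_1,\xi_2,\eta_2,\dots)'$. The block-diagonal operator $A:D(A)\to\ell^2$ acts on the pair $(\xi_n,\eta_n)'$ by the $2\times2$ matrix $A_n$, $n=0,1,2,\dots$, with domain $D(A)=\{x\in\ell^2: Ax\in\ell^2\}$. It generates the strongly continuous semigroup $e^{tA}={\rm diag}(e^{tA_0},e^{tA_1},e^{tA_2},\dots)$, $t\ge0$, on $\ell^2$. The vector $B$ is identified with the operator $\mathbb{R}\to\ell^2$, $u\mapsto Bu$. For $x^0\in\ell^2$ and $u\in L^2(0,\tau)$ (real-valued), the mild solution of $\dot x=Ax+Bu$ with $x|_{t=0}=x^0$ is $$x(t;x^0,u)=e^{tA}x^0+\int_0^t e^{(t-s)A}Bu(s)\,ds,\quad 0\le t\le\tau.$$ The system is called approximately controllable in time $\tau>0$ if for any $x^0,x^1\in\ell^2$ and any $\varepsilon>0$ there exists $u\in L^2(0,\tau)$ such that $\|x(\tau;x^0,u)-x^1\|_{\ell^2}<\varepsilon$. *)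

(* Defs.v *)
From HB Require Import structures.
From mathcomp Require Import all_boot all_order all_algebra.
From mathcomp Require Import all_classical all_reals all_analysis.

Set Implicit Arguments.
Unset Strict Implicit.
Unset Printing Implicit Defensive.

Import Order.TTheory GRing.Theory Num.Theory.
Import numFieldNormedType.Exports.

Local Open Scope classical_set_scope.
Local Open Scope ring_scope.

(* Sequences are indexed from 0: x 0, x 1, x 2, x 3, ... are the coordinates
   xi_0, eta_0, xi_1, eta_1, ..., i.e. x n.*2 = xi_n and x n.*2.+1 = eta_n. *)

Section Ell2.
Context {R : realType}.

Definition ell2 (x : nat -> R) : Prop :=
  cvgn (series (fun n => x n ^+ 2)).

(* meaningful on ell2 only *)
Definition ell2_norm (x : nat -> R) : R :=
  Num.sqrt (limn (series (fun n => x n ^+ 2))).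

Definition ell2_ip (x y : nat -> R) : R :=
  limn (series (fun n => x n * y n)).

(* The integral of an ell2-valued function is the weak (Pettis) integral: the
   vector J of ell2 such that <J, v> = \int_D <f s, v> ds for all v in ell2.
   It agrees with the Bochner integral whenever f is Bochner integrable. *)
Definition is_ell2_integral (D : set R) (f : R -> nat -> R) (J : nat -> R)
    : Prop :=
  [/\ forall s, D s -> ell2 (f s),
      ell2 J &
      forall v, ell2 v ->
        (@lebesgue_measure R).-integrable D (fun s => (ell2_ip (f s) v)%:E) /\
        ell2_ip J v = \int[@lebesgue_measure R]_(s in D) ell2_ip (f s) v].

Definition L2 (tau : R) (u : R -> R) : Prop :=
  measurable_fun `]0, tau[ u /\
  (\int[@lebesgue_measure R]_(s in `]0%R, tau[) (u s ^+ 2)%:E < +oo)%E.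

End Ell2.

Section ControlSystem.
Context {R : realType}.

Definition expmx (n : nat) (M : 'M[R]_n.+1) : 'M[R]_n.+1 :=
  limn (series (fun k => k`!%:R^-1 *: M ^+ k)).

(* diag(T_0, T_1, ...) x: the k-th coordinate is entry k mod 2 of the image
   under T_n of the pair (x_2n, x_2n+1), where n = k div 2. *)
Definition blockdiag (T : nat -> 'M[R]_2) (x : nat -> R) : nat -> R :=
  fun k => (T k./2 *m \col_(j < 2) x (k./2.*2 + j)%N) (inord (odd k)) 0.

(* e^{tA} for the block-diagonal operator A = diag(A_0, A_1, ...) *)
Definition semigroup (A : nat -> 'M[R]_2) (t : R) : (nat -> R) -> nat -> R :=
  blockdiag (fun n => expmx (t *: A n)).

(* y = x(t; x0, u), the value at time t of the mild solution *)
Definition is_mild_solution_at (A : nat -> 'M[R]_2) (B x0 : nat -> R)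
    (u : R -> R) (t : R) (y : nat -> R) : Prop :=
  exists J : nat -> R,
    is_ell2_integral `]0, t[
      (fun s => semigroup A (t - s) (fun k => B k * u s)) J /\
    forall k, y k = semigroup A t x0 k + J k.

Definition approx_controllable (A : nat -> 'M[R]_2) (B : nat -> R) (tau : R)
    : Prop :=
  forall x0 x1 : nat -> R, ell2 x0 -> ell2 x1 ->
  forall eps : R, 0 < eps ->
  exists u : R -> R, L2 tau u /\
  exists y : nat -> R,
    [/\ is_mild_solution_at A B x0 u tau y,
        ell2 y &
        ell2_norm (fun k => y k - x1 k) < eps].

Definition mx2 (a b c d : R) : 'M[R]_2 :=
  \matrix_(i < 2, j < 2)
    if i == 0 then (if j == 0 then a else b) else (if j == 0 then c else d).

Definition Ablock (omega : nat -> R) (kappa : R) (n : nat) : 'M[R]_2 :=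
  if n == 0%N then mx2 0 1
                       0 0
  else mx2 0           (omega n)
           (- omega n) (- (2 * kappa)).

(* (0, 1, 0, b_1, 0, b_2, ...); the value b 0 is not used *)
Definition Bvec (b : nat -> R) : nat -> R :=
  fun k => if odd k then (if k./2 == 0%N then 1 else b k./2) else 0.

End ControlSystem.

(* Main.v *)
Require Import Defs.
From HB Require Import structures.
From mathcomp Require Import all_boot all_order all_algebra.
From mathcomp Require Import all_classical all_reals all_analysis.
From mathcomp Require Import finmap measurable_realfun ring lra.

Set Implicit Arguments.
Unset Strict Implicit.
Unset Printing Implicit Defensive.

Import Order.TTheory GRing.Theory Num.Theory.
Import numFieldNormedType.Exports.

Local Open Scope classical_set_scope.
Local Open Scope ring_scope.

(** The coordinates of the integral term of the mild solution are moments of the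
    control, so the theorem is a moment problem.  Write [u s = v (tau - s)] and
    [mu_n = sqrt (omega_n^2 - kappa^2)].  Up to the factor [b_n] and a 2x2 change
    of coordinates that is bounded uniformly in [n], the [n]-th block of the
    integral consists of the moments of [v] on [[0, tau]] against
    [exp (- kappa t) sin (mu_n t)] and [exp (- kappa t) cos (mu_n t)], and the
    zeroth block of those against [t / tau] and [1] ([expmx_column],
    [mild_solution_of_control]).

    The control is sought as a finite combination of dual functions: the same
    oscillations multiplied by [2 exp (kappa t) / tau], together with the two
    affine functions biorthogonal to [t / tau] and [1].  Their matrix of pairings
    is the identity plus an error [E].  Integration by parts ([revint_osc]) bounds
    the entries of [E] by a constant times [1 / (tau |mu_i - mu_j|)], or
    [1 / (tau mu_i)] within a block or against the zeroth block, and
    [|mu_i - mu_j| >= |omega_i - omega_j|] ([freq_gap]) because both pairs have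
    the same difference of squares while [mu_i <= omega_i].  As long as
    [kappa tau <= 1/2] and [2 kappa] is below all [omega_n] the constant is
    absolute ([gram_error_le]).  The hypothesis on the frequencies, which also forces [sum 1 / omega_i^2] to converge
    ([weight_sums_bounded]), therefore makes the Hilbert-Schmidt norm of [E] of
    order [1 / tau], uniformly in [kappa]: a large [tau] makes it at most [1/2].

    Every finite section of [I + E] is then invertible, and if [a] solves such a
    section with data [c], all entries of [E a], including those beyond the
    section, are bounded by the norm of [c] ([near_identity_solve]).  To steer the
    system near a target [z], truncate [z] to finitely many coordinates; this
    fixes [c].  Solving larger and larger sections reproduces the truncated target
    exactly on the blocks below [N], while the coordinates beyond are bounded by a
    constant, independent of [N], times the weights [b_n].  These weights are
    square summable, so this tail vanishes as [N] grows
    ([approx_controllable_of_gram]).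

    Two analytic facts connect this computation with the definitions: the
    exponential of a damped block, obtained by summing Taylor series
    ([expmx_damped]), and the exchange of the pairing of [ell2] with the integral,
    by dominated convergence ([is_ell2_integral_revint]). *)

(** * Derivatives and convergence of Taylor series *)

Section Taylor.
Context {R : realType}.

Lemma is_derive_continuous (f : R -> R) (x df : R) :
  is_derive x 1 f df -> {for x, continuous f}.
Proof.
move=> [fd _]; apply: differentiable_continuous; exact/derivable1_diffP.
Qed.

Lemma is_derive_val_eq (f : R -> R) (x a b : R) : is_derive x 1 f a -> a = b ->
  is_derive x 1 f b.
Proof. by move=> df <-. Qed.

(** The differentiation rules below are stated for pointwise expressions, so that
    they apply to explicit formulas by unification. *)
Lemma is_derive_addf (f g : R -> R) (x a b : R) : is_derive x 1 f a ->
  is_derive x 1 g b -> is_derive x 1 (fun s => f s + g s) (a + b).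
Proof. exact: is_deriveD. Qed.

Lemma is_derive_subf (f g : R -> R) (x a b : R) : is_derive x 1 f a ->
  is_derive x 1 g b -> is_derive x 1 (fun s => f s - g s) (a - b).
Proof. exact: is_deriveB. Qed.

Lemma is_derive_mulf (f g : R -> R) (x a b : R) : is_derive x 1 f a ->
  is_derive x 1 g b ->
  is_derive x 1 (fun s => f s * g s) (f x * b + a * g x).
Proof.
move=> df dg; rewrite [a * _]mulrC; exact: (@is_deriveM R R f g x 1 a b).
Qed.

Lemma is_derive_scalef (c : R) (f : R -> R) (x a : R) : is_derive x 1 f a ->
  is_derive x 1 (fun s => c * f s) (c * a).
Proof. exact: (@is_deriveZ _ _ _ f c). Qed.

Lemma is_derive_exprn n (x : R) :
  is_derive x 1 (fun s : R => s ^+ n.+1) (n.+1%:R * x ^+ n).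
Proof.
elim: n => [|n IH].
  apply: (@is_derive_val_eq (fun s : R => s ^+ 1) x 1); last by rewrite expr0 mulr1.
have -> : (fun s : R => s ^+ n.+2) = (fun s => s * s ^+ n.+1).
  by apply/funext => s; rewrite exprS.
have h := is_derive_mulf (is_derive_id x (1:R)) IH. apply: (is_derive_val_eq h).
by rewrite exprS -[n.+2]addn1 natrD; ring.
Qed.

Lemma is_derive_comp_affine (f : R -> R) (a b x d : R) :
  is_derive (a * x + b) 1 f d ->
  is_derive x 1 (fun s => f (a * s + b)) (a * d).
Proof.
move=> df; rewrite mulrC.
apply: (@is_derive1_comp _ f (fun s => a * s + b)).
rewrite -[X in is_derive _ _ _ X]addr0 -[X in X + _]mulr1.
exact: (is_derive_addf (is_derive_scalef a (is_derive_id x (1:R)))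
  (is_derive_cst b x (1:R))).
Qed.

Lemma ler_deriv_ge0 (f f' : R -> R) (t : R) :
  (forall x : R, is_derive x 1 f (f' x)) ->
  (forall x : R, 0 <= x <= t -> 0 <= f' x) ->
  forall s : R, 0 <= s <= t -> f 0 <= f s.
Proof.
move=> df f'0 s /andP[s0 st].
have cf : {within `[0, t], continuous f}.
  apply: continuous_subspaceT => x; exact: is_derive_continuous (df x).
apply: (ger0_derive1_le_cc _ _ cf) => //.
- move=> x; rewrite in_itv /= => /andP[x0 xt].
  rewrite derive1E (@derive_val _ _ _ _ _ _ _ (df x)).
  by apply: f'0; rewrite !ltW.
- by rewrite in_itv /= lexx /= (le_trans s0).
- by rewrite in_itv /= s0.
Qed.

(** The mean value inequality in the form of a comparison with a majorant: both
    [g - h] and [g + h] are nondecreasing. *)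
Lemma ler_norm_deriv (h h' g g' : R -> R) (t : R) :
  (forall x : R, is_derive x 1 h (h' x)) -> (forall x : R, is_derive x 1 g (g' x)) ->
  (forall x : R, 0 <= x <= t -> `|h' x| <= g' x) ->
  forall s : R, 0 <= s <= t -> `|h s - h 0| <= g s - g 0.
Proof.
move=> dh dg hg s st.
have h1 := @ler_deriv_ge0 (g \- h) (fun x => g' x - h' x) t
   (fun x => is_deriveB (dg x) (dh x)).
have h2 := @ler_deriv_ge0 (g \+ h) (fun x => g' x + h' x) t
   (fun x => is_deriveD (dg x) (dh x)).
have {}h1 : g 0 - h 0 <= g s - h s.
  apply: h1 => // x /hg; rewrite ler_norml => /andP[_]; lra.
have {}h2 : g 0 + h 0 <= g s + h s.
  apply: h2 => // x /hg; rewrite ler_norml => /andP[+ _]; lra.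
rewrite ler_norml; apply/andP; split; lra.
Qed.

(** Induction on the order: the remainder of [f 0] has the remainder of [f 1] as its
    derivative, and the bound for the latter is integrated by comparison.  The
    functions [f k] are the successive derivatives of [f 0]. *)
Lemma taylor_remainder (t K : R) n (f : nat -> R -> R) :
  (forall k (x : R), is_derive x 1 (f k) (f k.+1 x)) ->
  (forall s : R, 0 <= s <= t -> `|f n s| <= K) ->
  forall s : R, 0 <= s <= t ->
    `|f 0%N s - \sum_(k < n) f k 0 * (k`!%:R^-1 * s ^+ k)| <= K * (n`!%:R^-1 * s ^+ n).
Proof.
elim: n f => [|n IH] f df fK s st.
  by rewrite big_ord0 subr0 fact0 invr1 expr0 !mulr1 fK.
have powD k (c x : R) : is_derive x 1 (fun s => c * (k.+1`!%:R^-1 * s ^+ k.+1))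
    (c * (k`!%:R^-1 * x ^+ k)).
  apply: (is_derive_val_eq (is_derive_scalef c (is_derive_scalef _ (is_derive_exprn k x)))).
  rewrite factS natrM.
  have k0 : k.+1%:R != 0 :> R by rewrite pnatr_eq0.
  have f0 : k`!%:R != 0 :> R by rewrite pnatr_eq0 -lt0n fact_gt0.
  move: k0 f0; move: (k.+1%:R) (k`!%:R) (x ^+ k) => u v w u0 v0.
  by field; rewrite u0 v0.
have dsum m (x : R) : is_derive x 1
    (fun s => \sum_(k < m.+1) f k 0 * (k`!%:R^-1 * s ^+ k))
    (\sum_(k < m) f k.+1 0 * (k`!%:R^-1 * x ^+ k)).
  have -> : (fun s => \sum_(k < m.+1) f k 0 * (k`!%:R^-1 * s ^+ k)) =
     cst (f 0%N 0) + (\sum_(k < m) (fun s => f k.+1 0 * (k.+1`!%:R^-1 * s ^+ k.+1))).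
    apply/funext => y; rewrite big_ord_recl /= fact0 invr1 expr0 !mulr1.
    by rewrite fctE fct_sumE.
  rewrite -[X in is_derive _ _ _ X]add0r.
  apply: is_deriveD.
have := @ler_norm_deriv (fun s => f 0%N s - \sum_(k < n.+1) f k 0 * (k`!%:R^-1 * s ^+ k))
  _ (fun s => K * (n.+1`!%:R^-1 * s ^+ n.+1)) _ t
  (fun x => is_deriveB (df 0%N x) (dsum n x)) (powD n K) (IH (fun k => f k.+1) _ fK)
  s st.
move=> /(_ (fun k => df k.+1)).
rewrite [_ * (_ * 0 ^+ _)]mulrA expr0n /= mulr0 subr0.
suff -> : f 0%N 0 - \sum_(k < n.+1) f k 0 * (k`!%:R^-1 * 0 ^+ k) = 0 by rewrite subr0.
rewrite big_ord_recl /= fact0 invr1 expr0 !mulr1 big1 ?addr0 ?subrr // => i _.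
by rewrite expr0n /= !mulr0.
Qed.

(** Geometric growth of the derivatives makes the Taylor remainder smaller than a
    term of an exponential series. *)
Lemma taylor_cvg (t D C : R) (f : nat -> R -> R) :
  0 <= t ->
  (forall k (x : R), is_derive x 1 (f k) (f k.+1 x)) ->
  (forall k (s : R), 0 <= s <= t -> `|f k s| <= D * C ^+ k) ->
  series (fun k => f k 0 * (k`!%:R^-1 * t ^+ k)) @ \oo --> f 0%N t.
Proof.
move=> t0 df fD.
have c0 : (fun n => D * exp_coeff (C * t) n) @ \oo --> (0 : R).
  rewrite -[X in _ --> X](mulr0 D); apply: cvgMr; exact: cvg_exp_coeff.
apply/subr_cvg0.
apply: norm_cvg0.
apply: (@squeeze_cvgr _ _ _ _ (cst 0) (fun n => D * exp_coeff (C * t) n)).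
- apply: nearW => n; rewrite normr_ge0 /=.
  rewrite distrC /series /= big_mkord.
  have := @taylor_remainder t (D * C ^+ n) n f df (fD n) t.
  rewrite t0 lexx => /(_ isT)/le_trans; apply.
  rewrite /exp_coeff /= exprMn. lra.
- exact: cvg_cst.
- exact: c0.
Qed.

End Taylor.

(** * Exponentials of matrices with a scalar square up to damping *)

Section Expmx.
Context {R : realType}.

Lemma cvg_mx_entrywise m n (u : nat -> 'M[R]_(m.+1, n.+1))
    (M : 'M[R]_(m.+1, n.+1)) :
  (forall i j, (fun k => u k i j) @ \oo --> M i j) -> u @ \oo --> M.
Proof.
move=> h; apply/cvgrPdist_lt => e e0.
have : \forall k \near \oo, forall i, forall j, `|M i j - u k i j| < e.
  apply: filter_forall => i; apply: filter_forall => j.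
  by have /cvgrPdist_lt := h i j; apply.
apply: filterS => k hk.
rewrite [ `|_| ]mx_normrE.
apply: bigmax_lt => // -[i j] _ /=.
by have := hk i j; rewrite !mxE.
Qed.

(** The [k]-th derivatives of a pair [(a, b)] with [a' = - kap a - m b] and
    [b' = a - kap b].  The same recurrence gives the coordinates on [1] and [N] of
    the powers of [N - kap] when [N ^ 2 = - m], which identifies the exponential
    series of that matrix with two scalar Taylor series. *)
Fixpoint damped_iter (kap m : R) (a b : R -> R) (k : nat) : (R -> R) * (R -> R) :=
  if k is k'.+1 then let: (p, q) := damped_iter kap m a b k' in
    ((fun t => - kap * p t - m * q t), (fun t => p t - kap * q t))
  else (a, b).

Lemma is_derive_damped_iter (kap m : R) (a b : R -> R) :
  (forall t : R, is_derive t 1 a (- kap * a t - m * b t)) ->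
  (forall t : R, is_derive t 1 b (a t - kap * b t)) ->
  forall k (t : R),
    is_derive t 1 (damped_iter kap m a b k).1 ((damped_iter kap m a b k.+1).1 t) /\
    is_derive t 1 (damped_iter kap m a b k).2 ((damped_iter kap m a b k.+1).2 t).
Proof.
move=> da db; elim=> [//|k IH] t.
move: (IH t) => /=; case: (damped_iter kap m a b k) => p q /= [dp dq].
split; [apply: is_derive_subf|apply: is_derive_subf] => //; exact: is_derive_scalef.
Qed.

Lemma damped_iter_bound (kap m D t : R) (a b : R -> R) : 0 <= D ->
  `|a t| <= D -> `|b t| <= D -> forall k,
  `|(damped_iter kap m a b k).1 t| <= D * (`|kap| + `|m| + 1) ^+ k /\
  `|(damped_iter kap m a b k).2 t| <= D * (`|kap| + `|m| + 1) ^+ k.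
Proof.
move=> D0 ha hb; elim=> [|k]; first by rewrite expr0 mulr1.
rewrite /=; case: (damped_iter kap m a b k) => p q /= [].
rewrite exprSr mulrA.
set K := D * _ => hp hq.
have K0 : 0 <= K by exact: le_trans (normr_ge0 _) hp.
have h1 : `|kap * p t| <= `|kap| * K by rewrite normrM ler_wpM2l.
have h2 : `|m * q t| <= `|m| * K by rewrite normrM ler_wpM2l.
have h3 : `|kap * q t| <= `|kap| * K by rewrite normrM ler_wpM2l.
have h4 : 0 <= `|m| * K by rewrite mulr_ge0.
have h5 : 0 <= `|kap| * K by rewrite mulr_ge0.
split.
  apply: (le_trans (ler_normB _ _)); rewrite mulNr normrN. lra.
apply: (le_trans (ler_normB _ _)). lra.
Qed.

Lemma damped_iter_expr n (N : 'M[R]_n.+1) (kap m : R) (a b : R -> R) :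
  N * N = - m *: 1 -> a 0 = 1 -> b 0 = 0 -> forall k,
  (N - kap *: 1) ^+ k =
    (damped_iter kap m a b k).1 0 *: 1 + (damped_iter kap m a b k).2 0 *: N.
Proof.
move=> NN a0 b0; elim=> [|k IH]; first by rewrite /= a0 b0 scale1r scale0r addr0.
rewrite exprSr {}IH /=; case: (damped_iter kap m a b k) => p q /=.
rewrite mulrDl !mulrBr -!scalerAl -!scalerAr NN !mulr1 mul1r !scalerA.
apply/matrixP => i j; rewrite !mxE; ring.
Qed.

(** The functions [exp (- kap t) c t] and [exp (- kap t) s t] are the sums of their
    Taylor series, whose coefficients are the coordinates of the powers of
    [N - kap].  Covers both the undamped nilpotent block ([c = 1], [s = t]) and the
    oscillating ones ([c] a cosine, [s] a sine divided by its frequency). *)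
Lemma expmx_damped n (N : 'M[R]_n.+1) (kap m D t : R) (c s : R -> R) :
  N * N = - m *: 1 -> 0 <= kap -> 0 <= t ->
  (forall x : R, is_derive x 1 c (- m * s x)) ->
  (forall x : R, is_derive x 1 s (c x)) ->
  c 0 = 1 -> s 0 = 0 ->
  (forall x : R, 0 <= x <= t -> `|c x| <= D /\ `|s x| <= D) ->
  expmx (t *: (N - kap *: 1)) =
    (expR (- kap * t) * c t) *: 1 + (expR (- kap * t) * s t) *: N.
Proof.
move=> NN kap0 t0 dc ds c0 s0 csD.
pose a x := expR (- kap * x) * c x; pose b x := expR (- kap * x) * s x.
have de (x : R) : is_derive x 1 (fun y => expR (- kap * y)) (- kap * expR (- kap * x)).
  have h := @is_derive_comp_affine R expR (- kap) 0 x _ (is_derive_expR _).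
  have -> : (fun y => expR (- kap * y)) = (fun y => expR (- kap * y + 0)).
    by apply/funext => y; rewrite addr0.
  by apply: (is_derive_val_eq h); rewrite addr0.
have da (x : R) : is_derive x 1 a (- kap * a x - m * b x).
  apply: (is_derive_val_eq (is_derive_mulf (de x) (dc x))); rewrite /a /b; ring.
have db (x : R) : is_derive x 1 b (a x - kap * b x).
  apply: (is_derive_val_eq (is_derive_mulf (de x) (ds x))); rewrite /a /b; ring.
have e1 x : 0 <= x -> 0 <= expR (- kap * x) <= 1.
  by move=> x0; rewrite expR_ge0 expR_le1 mulNr oppr_le0 mulr_ge0.
have abD x : 0 <= x <= t -> `|a x| <= D /\ `|b x| <= D.
  move=> xt; have [cD sD] := csD x xt.
  case/andP: xt => /e1/andP[e0 {}e1] _.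
  rewrite /a /b !normrM (ger0_norm e0); split;
    [apply: (le_trans _ cD); exact: ler_piMl|apply: (le_trans _ sD); exact: ler_piMl].
have D0 : 0 <= D.
  have h0 : 0 <= (0 : R) <= t by rewrite lexx.
  by have [c0D _] := csD _ h0; exact: le_trans (normr_ge0 _) c0D.
have der := is_derive_damped_iter da db.
have bnd k x (xt : 0 <= x <= t) :=
  damped_iter_bound kap m D0 (abD x xt).1 (abD x xt).2 k.
have cv1 := taylor_cvg t0 (fun k x => (der k x).1) (fun k x xt => (bnd k x xt).1).
have cv2 := taylor_cvg t0 (fun k x => (der k x).2) (fun k x xt => (bnd k x xt).2).
apply: cvg_lim => //.
have a0 : a 0 = 1 by rewrite /a mulr0 expR0 c0 mulr1.
have b0 : b 0 = 0 by rewrite /b s0 mulr0.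
apply: cvg_mx_entrywise => i j.
have -> : (fun k => series (fun k => k`!%:R^-1 *: (t *: (N - kap *: 1)) ^+ k) k i j) =
  (fun k => series (fun k => (damped_iter kap m a b k).1 0 * (k`!%:R^-1 * t ^+ k)) k
     * (1 : 'M[R]_n.+1) i j
   + series (fun k => (damped_iter kap m a b k).2 0 * (k`!%:R^-1 * t ^+ k)) k * N i j).
  apply/funext => k; rewrite /series /= summxE !mulr_suml -big_split /=.
  apply: eq_bigr => l _.
  rewrite exprZn (damped_iter_expr kap NN a0 b0) !mxE; ring.
rewrite !mxE; apply: cvgD; apply: cvgMl => //.
Qed.

End Expmx.

(** * The blocks of the semigroup *)

Section Blocks.
Context {R : realType}.

Lemma mx2E (a b c d : R) : [/\ mx2 a b c d 0 0 = a, mx2 a b c d 0 1 = b,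
  mx2 a b c d 1 0 = c & mx2 a b c d 1 1 = d].
Proof. by split; rewrite mxE. Qed.

Lemma mx2_eqP (M : 'M[R]_2) (a b c d : R) : M 0 0 = a -> M 0 1 = b -> M 1 0 = c ->
  M 1 1 = d -> M = mx2 a b c d.
Proof.
have [e00 e01 e10 e11] := mx2E a b c d.
move=> h00 h01 h10 h11; apply/matrixP => i j.
have ord2 (k : 'I_2) : k = 0 \/ k = 1.
  by case: k => [[|[|//]] lt]; [left|right]; exact/val_inj.
by case: (ord2 i) => ->; case: (ord2 j) => ->; congruence.
Qed.

Lemma mulmx2E (M N : 'M[R]_2) i j : (M * N) i j = M i 0 * N 0 j + M i 1 * N 1 j.
Proof.
rewrite /GRing.mul /= mxE big_ord_recl big_ord1.
by congr (_ + M i _ * N _ j); exact/val_inj.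
Qed.

Lemma blockdiagE (T : nat -> 'M[R]_2) (x : nat -> R) k :
  blockdiag T x k = T k./2 (inord (odd k)) 0 * x k./2.*2 +
                    T k./2 (inord (odd k)) 1 * x k./2.*2.+1.
Proof.
rewrite /blockdiag mxE big_ord_recl big_ord1 !mxE /= addn0 addn1.
by congr (_ + T _ _ _ * _); exact/val_inj.
Qed.

Lemma expmx_Ablock0 (omega : nat -> R) (kap t : R) : 0 <= t ->
  expmx (t *: Ablock omega kap 0) = mx2 1 t 0 1.
Proof.
move=> t0; have [e00 e01 e10 e11] := mx2E (0 : R) 1 0 0.
have NN : mx2 (0 : R) 1 0 0 * mx2 0 1 0 0 = - 0 *: 1.
  rewrite oppr0 scale0r; apply/matrixP => i j; rewrite mulmx2E !mxE.
  by case: (i == 0); case: (j == 0); rewrite /= ?mulr0 ?mul0r ?addr0.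
have dc (x : R) : is_derive x 1 (cst (1 : R)) (- 0 * x).
  by apply: (is_derive_val_eq (is_derive_cst (1 : R) x 1)); rewrite oppr0 mul0r.
have ds (x : R) : is_derive x 1 id (cst (1 : R) x) by exact: is_derive_id.
have bnd (x : R) : 0 <= x <= t -> `|cst (1 : R) x| <= 1 + t /\ `|x| <= 1 + t.
  by move=> /andP[x0 xt]; rewrite normr1 ger0_norm //; split; lra.
have := expmx_damped NN (lexx _) t0 dc ds erefl erefl bnd.
rewrite scale0r subr0 oppr0 mul0r expR0 !mul1r scale1r => ->.
by apply: mx2_eqP; rewrite !mxE /=; ring.
Qed.

(** The frequency at which the damped [n]-th block oscillates. *)
Definition freq (omega : nat -> R) (kap : R) (n : nat) : R :=
  Num.sqrt (omega n ^+ 2 - kap ^+ 2).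

Lemma sqr_freq (omega : nat -> R) (kap : R) n : 0 <= kap <= omega n ->
  freq omega kap n ^+ 2 = omega n ^+ 2 - kap ^+ 2.
Proof. by move=> h; rewrite sqr_sqrtr //; nra. Qed.

Lemma freq_gt0 (omega : nat -> R) (kap : R) n : 0 <= kap < omega n ->
  0 < freq omega kap n.
Proof. by move=> h; rewrite sqrtr_gt0; nra. Qed.

Lemma is_derive_cosM (a x : R) :
  is_derive x 1 (fun t => cos (a * t)) (- a * sin (a * x)).
Proof.
have -> : (fun t => cos (a * t)) = (fun t => cos (a * t + 0)).
  by apply/funext => t; rewrite addr0.
apply: (is_derive_val_eq (is_derive_comp_affine (is_derive_cos _))).
by rewrite addr0 mulrN mulNr.
Qed.

Lemma is_derive_sinM (a x : R) :
  is_derive x 1 (fun t => sin (a * t)) (a * cos (a * x)).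
Proof.
have -> : (fun t => sin (a * t)) = (fun t => sin (a * t + 0)).
  by apply/funext => t; rewrite addr0.
by apply: (is_derive_val_eq (is_derive_comp_affine (is_derive_sin _))); rewrite addr0.
Qed.

(** The [n]-th block plus [kap] has square [- mu ^ 2], by Cayley-Hamilton. *)
Lemma expmx_AblockS (omega : nat -> R) (kap t : R) n (mu := freq omega kap n) :
  (0 < n)%N -> 0 <= kap < omega n -> 0 <= t ->
  expmx (t *: Ablock omega kap n) = expR (- kap * t) *:
    mx2 (cos (mu * t) + kap / mu * sin (mu * t)) (omega n / mu * sin (mu * t))
        (- (omega n / mu * sin (mu * t))) (cos (mu * t) - kap / mu * sin (mu * t)).
Proof.
move=> n0 kw t0; pose N := mx2 kap (omega n) (- omega n) (- kap).
have [e00 e01 e10 e11] := mx2E kap (omega n) (- omega n) (- kap).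
have mu0 : 0 < mu by exact: freq_gt0.
have mu2 : mu ^+ 2 = omega n ^+ 2 - kap ^+ 2.
  by apply: sqr_freq; case/andP: kw => -> /ltW.
have NN : N * N = - mu ^+ 2 *: 1.
  rewrite mu2 [RHS](mx2_eqP (a := kap ^+ 2 - omega n ^+ 2) (b := 0) (c := 0)
    (d := kap ^+ 2 - omega n ^+ 2)) ?mxE /=; [|ring..].
  by apply: mx2_eqP; rewrite mulmx2E ?(e00, e01, e10, e11); ring.
have -> : Ablock omega kap n = N - kap *: 1.
  rewrite /Ablock; case: n n0 {kw mu mu0 mu2 e00 e01 e10 e11 NN} @N => // n _.
  by apply/esym/mx2_eqP; rewrite !mxE /=; ring.
have muV : 0 <= mu^-1 by rewrite invr_ge0 ltW.
have dc (x : R) : is_derive x 1 (fun x => cos (mu * x))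
    (- mu ^+ 2 * (mu^-1 * sin (mu * x))).
  apply: (is_derive_val_eq (is_derive_cosM mu x)).
  by field; exact: lt0r_neq0.
have ds (x : R) : is_derive x 1 (fun x => mu^-1 * sin (mu * x)) (cos (mu * x)).
  apply: (is_derive_val_eq (is_derive_scalef _ (is_derive_sinM mu x))).
  by rewrite mulrA mulVf ?mul1r //; exact: lt0r_neq0.
have bnd (x : R) : 0 <= x <= t -> `|cos (mu * x)| <= 1 + mu^-1 /\
    `|mu^-1 * sin (mu * x)| <= 1 + mu^-1.
  move=> _; split; first by apply: (le_trans (cos_max _)); rewrite lerDl.
  rewrite normrM (ger0_norm muV).
  by apply: (le_trans (ler_piMr _ (sin_max _))) => //; rewrite lerDr.
have [kap0 _] := andP kw.
rewrite (expmx_damped NN kap0 t0 dc ds _ _ bnd); last 2 first.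
- by rewrite mulr0 cos0.
- by rewrite mulr0 sin0 mulr0.
rewrite -!scalerA -scalerDr; congr (_ *: _).
by apply: mx2_eqP; rewrite !mxE /=; field; exact: lt0r_neq0.
Qed.

Lemma freq_ge (omega : nat -> R) (kap : R) n : 0 < kap -> 2 * kap <= omega n ->
  omega n / 2 <= freq omega kap n.
Proof.
move=> k0 kw.
have m2 : freq omega kap n ^+ 2 = omega n ^+ 2 - kap ^+ 2.
  apply: sqr_freq; lra.
have : 0 <= freq omega kap n by exact: sqrtr_ge0.
move: (freq omega kap n) m2 => mu m2 mu0; nra.
Qed.

Lemma expmx_Ablock_bound (omega : nat -> R) (kap t tau : R) n i j :
  0 < kap -> ((0 < n)%N -> 2 * kap <= omega n) -> 0 <= t <= tau ->
  `|expmx (t *: Ablock omega kap n) i j| <= 2 + tau.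
Proof.
move=> k0 kw /andP[t0 tt].
case: (posnP n) => [->|n0].
  rewrite expmx_Ablock0 // mxE.
  by do 2! case: ifP => _; rewrite ?normr0 ?normr1 ?ger0_norm //; lra.
have {}kw := kw n0; set mu := freq omega kap n.
have muw : omega n / 2 <= mu by exact: freq_ge.
have mu0 : 0 < mu by lra.
rewrite expmx_AblockS //; last lra.
rewrite mxE normrM ger0_norm ?expR_ge0 //.
have e1 : expR (- kap * t) <= 1 by rewrite expR_le1; nra.
have q : `|kap / mu * sin (mu * t)| <= 1.
  rewrite normrM -[1]mulr1 ler_pM // ?sin_max // ger0_norm.
    by rewrite ler_pdivrMr //; lra.
  by rewrite divr_ge0 // ltW.
have p : `|omega n / mu * sin (mu * t)| <= 2.
  rewrite normrM -[2]mulr1 ler_pM // ?sin_max // ger0_norm.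
    by rewrite ler_pdivrMr //; lra.
  by rewrite divr_ge0 //; lra.
have c1 := cos_max (mu * t).
suff h : `|mx2 (cos (mu * t) + kap / mu * sin (mu * t))
  (omega n / mu * sin (mu * t)) (- (omega n / mu * sin (mu * t)))
  (cos (mu * t) - kap / mu * sin (mu * t)) i j| <= 2.
  apply: (@le_trans _ _ 2); last lra.
  by rewrite -[2]mul1r ler_pM // ?expR_ge0.
rewrite mxE; do 2! case: ifP => _ //; rewrite ?normrN //.
  apply: (le_trans (ler_normD _ _)); lra.
apply: (le_trans (ler_normB _ _)); lra.
Qed.

End Blocks.

(** Damping preserves differences of squares, and it lowers each frequency, so it
    cannot bring two of them closer. *)
Lemma freq_gap (R : realType) (omega : nat -> R) (kap : R) (i j : nat) :
  0 <= kap < omega i -> 0 <= kap < omega j ->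
  `|omega i - omega j| <= `|freq omega kap i - freq omega kap j|.
Proof.
move=> hi hj.
have mi := freq_gt0 hi; have mj := freq_gt0 hj.
have si : freq omega kap i ^+ 2 = omega i ^+ 2 - kap ^+ 2 by apply: sqr_freq; lra.
have sj : freq omega kap j ^+ 2 = omega j ^+ 2 - kap ^+ 2 by apply: sqr_freq; lra.
move: (freq _ _ i) (freq _ _ j) mi mj si sj => x y x0 y0 sx sy.
have xi : x <= omega i by nra.
have yj : y <= omega j by nra.
have s0 : 0 < omega i + omega j by lra.
rewrite -(ler_pM2r s0) -[X in _ * X <= _](ger0_norm (ltW s0)) -normrM.
have -> : (omega i - omega j) * (omega i + omega j) = (x - y) * (x + y).
  by rewrite -!subr_sqr sx sy; ring.
rewrite normrM ler_wpM2l // ger0_norm; lra.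
Qed.

(** * Oscillatory integrals *)

Section ReversedIntegral.
Context {R : realType}.
Notation mu := (@lebesgue_measure R).

(** The integral is taken in the time variable of the control and the integrand in
    the reversed one, because the kernel of the mild solution is evaluated at
    [tau - s]. *)
Definition revint (tau : R) (F : R -> R) : R :=
  \int[mu]_(s in `]0, tau[) F (tau - s).

Variable tau : R.
Hypothesis tau0 : 0 < tau.

Lemma continuous_rev (F : R -> R) :
  continuous F -> continuous (fun s => F (tau - s)).
Proof.
move=> cF s; apply: (@continuous_comp _ _ _ (fun s => tau - s) F).
  by apply: cvgB; [exact: cvg_cst|exact: cvg_id].
exact: cF.
Qed.

Lemma revint_integrable (F : R -> R) : continuous F ->
  mu.-integrable `]0, tau[ (EFin \o (fun s => F (tau - s))).
Proof.
move=> cF; apply: (@integrableS _ _ _ mu `[0, tau]) => //.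
  exact: subset_itv_oo_cc.
apply: continuous_compact_integrable; first exact: segment_compact.
by apply: continuous_subspaceT; exact: continuous_rev.
Qed.

Lemma revintD (F G : R -> R) : continuous F -> continuous G ->
  revint tau (fun t => F t + G t) = revint tau F + revint tau G.
Proof. by move=> cF cG; apply: RintegralD => //; exact: revint_integrable. Qed.

Lemma revintZ (c : R) (F : R -> R) : continuous F ->
  revint tau (fun t => c * F t) = c * revint tau F.
Proof. by move=> cF; apply: RintegralZl => //; exact: revint_integrable. Qed.

Lemma revint_sum n (F : nat -> R -> R) : (forall i, continuous (F i)) ->
  continuous (fun t => \sum_(i < n) F i t) /\
  revint tau (fun t => \sum_(i < n) F i t) = \sum_(i < n) revint tau (F i).
Proof.
move=> cF; elim: n => [|n [cS IH]].
  rewrite big_ord0; split.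
    by move=> t; under eq_fun do rewrite big_ord0; exact: cvg_cst.
  rewrite -[RHS](mul0r (revint tau (cst 0))) -revintZ; last by move=> t; exact: cvg_cst.
  by congr (revint _ _); apply/funext => t; rewrite big_ord0 mul0r.
have -> : (fun t => \sum_(i < n.+1) F i t) =
    (fun t => \sum_(i < n) F i t + F n t).
  by apply/funext => t; rewrite big_ord_recr.
split; first by move=> t; apply: cvgD; [exact: cS|exact: cF].
by rewrite revintD // IH big_ord_recr.
Qed.

Lemma revint_bound (K : R) (F : R -> R) : continuous F ->
  (forall t : R, 0 <= t <= tau -> `|F t| <= K) -> `|revint tau F| <= K * tau.
Proof.
move=> cF FK.
have iF := revint_integrable cF.
apply: (le_trans (le_normr_Rintegral _ iF)) => //.
have -> : K * tau = \int[mu]_(s in `]0, tau[) K.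
  by rewrite Rintegral_cst //= lebesgue_measure_itv /= lte_fin tau0 oppr0 addr0.
apply: le_Rintegral => //.
- exact: (integrable_norm iF).
- apply: (@integrableS _ _ _ mu `[0, tau]) => //; first exact: subset_itv_oo_cc.
  apply: continuous_compact_integrable; first exact: segment_compact.
  by apply: continuous_subspaceT => x; exact: cvg_cst.
move=> s /=; rewrite in_itv /= => /andP[s0 st]; apply: FK; lra.
Qed.

Lemma revint_FTC (F f : R -> R) : continuous f ->
  (forall t : R, is_derive t 1 F (f t)) -> revint tau f = F tau - F 0.
Proof.
move=> cf dF.
have cF : continuous F by move=> t; exact: is_derive_continuous (dF t).
rewrite /revint Rintegral_itv_obnd_cbnd; last exact: revint_integrable.
rewrite Rintegral_itv_bndo_bndc; last first.
  apply: (@integrableS _ _ _ mu `[0, tau]) => //; first exact: subset_itv_co_cc.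
  apply: continuous_compact_integrable; first exact: segment_compact.
  by apply: continuous_subspaceT; exact: continuous_rev.
have dG (s : R) : is_derive s 1 (fun s => - F (tau - s)) (f (tau - s)).
  have h := is_derive_scalef (-1) (@is_derive_comp_affine _ F (-1) tau s _ (dF _)).
  have -> : (fun s => - F (tau - s)) = (fun s => -1 * F (-1 * s + tau)).
    by apply/funext => x; rewrite !mulN1r addrC.
  by apply: (is_derive_val_eq h); rewrite !mulN1r opprK addrC.
rewrite /Rintegral (@continuous_FTC2 _ _ (fun s => - F (tau - s))) //=.
- by rewrite subrr subr0 opprK addrC.
- by apply: continuous_subspaceT; exact: continuous_rev.
- split; first by [].
  + apply: cvg_at_right_filter; exact: is_derive_continuous (dG _).
  + apply: cvg_at_left_filter; exact: is_derive_continuous (dG _).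
- move=> s _; rewrite derive1E; exact: derive_val.
Qed.

(** Integration by parts against [sin (nu t + th) / nu]: the two boundary terms
    cost [H] each, and the remaining integral at most [tau H']. *)
Lemma revint_osc (h h' : R -> R) (nu th H H' : R) : nu != 0 ->
  continuous h' -> (forall t : R, is_derive t 1 h (h' t)) ->
  (forall t : R, 0 <= t <= tau -> `|h t| <= H) ->
  (forall t : R, 0 <= t <= tau -> `|h' t| <= H') ->
  `|revint tau (fun t => h t * cos (nu * t + th))| <= (2 * H + tau * H') / `|nu|.
Proof.
move=> nu0 ch' dh hH hH'.
have ch : continuous h by move=> t; exact: is_derive_continuous (dh t).
have dc (t : R) := @is_derive_comp_affine R cos nu th t _ (is_derive_cos _).
have ds (t : R) := @is_derive_comp_affine R sin nu th t _ (is_derive_sin _).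
have cc : continuous (fun t => cos (nu * t + th)).
  by move=> t; exact: is_derive_continuous (dc t).
have cs : continuous (fun t => sin (nu * t + th)).
  by move=> t; exact: is_derive_continuous (ds t).
have c1 : continuous (fun t => h t * cos (nu * t + th)).
  by move=> t; apply: cvgM; [exact: ch|exact: cc].
have c2 : continuous (fun t => h' t * sin (nu * t + th)).
  by move=> t; apply: cvgM; [exact: ch'|exact: cs].
have E : nu * revint tau (fun t => h t * cos (nu * t + th)) =
   h tau * sin (nu * tau + th) - h 0 * sin (nu * 0 + th)
   - revint tau (fun t => h' t * sin (nu * t + th)).
  have <- : revint tau (fun t => nu * (h t * cos (nu * t + th)) + h' t * sin (nu * t + th))
     = h tau * sin (nu * tau + th) - h 0 * sin (nu * 0 + th).
    apply: (@revint_FTC (fun t => h t * sin (nu * t + th))).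
      by move=> t; apply: cvgD; [apply: cvgMr; exact: c1|exact: c2].
    by move=> t; apply: (is_derive_val_eq (is_derive_mulf (dh t) (ds t))); ring.
  rewrite revintD // ?revintZ ?addrK //.
  by move=> t; apply: cvgMr; exact: c1.
rewrite ler_pdivlMr ?normr_gt0 // mulrC -normrM E.
apply: (le_trans (ler_normB _ _)); rewrite [2 * H]mulr_natl mulr2n.
have b s : 0 <= s <= tau -> `|h s * sin (nu * s + th)| <= H.
  move=> st; rewrite normrM; apply: le_trans (hH _ st).
  by apply: ler_piMr => //; exact: sin_max.
apply: lerD; last first.
  rewrite mulrC; apply: revint_bound => // t ht.
  rewrite normrM; apply: le_trans (hH' _ ht).
  by apply: ler_piMr => //; exact: sin_max.
apply: (le_trans (ler_normB _ _)); apply: lerD; apply: b; rewrite lexx ?andbT; exact: ltW.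
Qed.

End ReversedIntegral.

(** * Square-summable sequences and termwise integration *)

Section Ell2Lemmas.
Context {R : realType}.

Lemma ell2_of_bound (x : nat -> R) (C : R) :
  (forall n, \sum_(k < n) x k ^+ 2 <= C) ->
  ell2 x /\ limn (series (fun n => x n ^+ 2)) <= C.
Proof.
move=> hC.
have ser n : series (fun n => x n ^+ 2) n <= C by rewrite /series /= big_mkord.
have ell : ell2 x.
  apply: nondecreasing_is_cvgn.
    by apply: nondecreasing_series => n _ _; exact: sqr_ge0.
  by exists C => _ [n _ <-].
by split=> //; apply: limr_le => //; apply: nearW.
Qed.

Lemma ell2_sum_le (x : nat -> R) n : ell2 x ->
  \sum_(k < n) x k ^+ 2 <= limn (series (fun n => x n ^+ 2)).
Proof.
move=> ex; rewrite -(big_mkord xpredT (fun k => x k ^+ 2)).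
apply: (@nondecreasing_cvgn_le _ (series (fun n => x n ^+ 2))) => //.
by apply: nondecreasing_series => m _ _; exact: sqr_ge0.
Qed.

Lemma ell2_norm_lt (x : nat -> R) (e : R) : 0 < e ->
  limn (series (fun n => x n ^+ 2)) < e ^+ 2 -> ell2_norm x < e.
Proof.
move=> e0 h; rewrite -(ger0_norm (ltW e0)) -sqrtr_sqr.
by rewrite ltr_sqrt // exprn_gt0.
Qed.

Lemma ell2_le (x y : nat -> R) (K : R) : (forall k, `|x k| <= K * `|y k|) ->
  ell2 y -> ell2 x.
Proof.
move=> xy ey.
suff /ell2_of_bound[] : forall n, \sum_(k < n) x k ^+ 2 <=
  K ^+ 2 * limn (series (fun n => y n ^+ 2)) by [].
move=> n; apply: (@le_trans _ _ (K ^+ 2 * \sum_(k < n) y k ^+ 2)).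
  rewrite mulr_sumr; apply: ler_sum => k _.
  rewrite -(real_normK (num_real (x k))) -(real_normK (num_real (y k))) -exprMn.
  by apply: lerXn2r => //; rewrite nnegrE // (le_trans (normr_ge0 _) (xy k)).
by apply: ler_wpM2l; [exact: sqr_ge0|exact: ell2_sum_le].
Qed.

Lemma ell2D (x y : nat -> R) : ell2 x -> ell2 y -> ell2 (fun k => x k + y k).
Proof.
move=> ex ey.
suff h : forall n, \sum_(k < n) (x k + y k) ^+ 2 <=
  2 * (limn (series (fun n => x n ^+ 2)) + limn (series (fun n => y n ^+ 2))).
  by have [] := @ell2_of_bound (fun k => x k + y k) _ h.
move=> n; apply: (@le_trans _ _ (2 * (\sum_(k < n) x k ^+ 2 + \sum_(k < n) y k ^+ 2))).
  rewrite -big_split mulr_sumr; apply: ler_sum => k _ /=; have := sqr_ge0 (x k - y k); nra.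
by rewrite ler_pM2l //; apply: lerD; exact: ell2_sum_le.
Qed.

Lemma ell2_prod_bounded (x y : nat -> R) : ell2 x -> ell2 y ->
  exists C, forall n, \sum_(k < n) `|x k| * `|y k| <= C.
Proof.
move=> ex ey; exists (limn (series (fun n => x n ^+ 2)) + limn (series (fun n => y n ^+ 2))).
move=> n; apply: (le_trans _ (lerD (ell2_sum_le n ex) (ell2_sum_le n ey))).
rewrite -big_split; apply: ler_sum => k _ /=.
rewrite -(real_normK (num_real (x k))) -(real_normK (num_real (y k))).
by have := normr_ge0 (x k); have := normr_ge0 (y k); nra.
Qed.

Lemma cvg_series_bounded (x : nat -> R) (C : R) :
  (forall n, \sum_(k < n) `|x k| <= C) -> cvgn (series x).
Proof.
move=> hC; apply: normed_cvg; apply: nondecreasing_is_cvgn.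
  by apply: nondecreasing_series => n _ _ /=.
exists C => _ [n _ <-]; have := hC n.
by rewrite -(big_mkord xpredT (fun k => `|x k|)).
Qed.

(** A partial sum within [e] of the limit leaves at most [e] for any later terms. *)
Lemma ell2_tail (x : nat -> R) (e : R) : ell2 x -> 0 < e ->
  exists M, forall m n, (M <= m)%N ->
    \sum_(k < n | (m <= k)%N) x k ^+ 2 <= e.
Proof.
move=> ex e0; set L := limn (series (fun n => x n ^+ 2)).
have /cvgrPdist_lt/(_ _ e0)[M _ hM] :
  series (fun n => x n ^+ 2) @ \oo --> L by exact: ex.
exists M => m n Mm.
have [nm|/ltnW mn] := leqP n m.
  rewrite big_pred0 ?ltW // => k; apply/negbTE; rewrite -ltnNge.
  exact: leq_trans (ltn_ord k) nm.
have := ell2_sum_le n ex; rewrite (bigID (fun k : 'I_n => (m <= k)%N)) /=.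
rewrite -[X in _ + X <= _ -> _](_ : \sum_(k < m) x k ^+ 2 = _); last first.
  rewrite -(big_mkord xpredT (fun k => x k ^+ 2)) (big_nat_widen _ _ n) //.
  by rewrite big_mkord; apply: eq_bigl => k /=; rewrite ltnNge.
have := hM m Mm; rewrite /= /series /= big_mkord ltr_norml => /andP[_].
rewrite -/L; lra.
Qed.

End Ell2Lemmas.

Section TermwiseIntegration.
Context {R : realType}.
Notation mu := (@lebesgue_measure R).

(** A family of continuous coordinates dominated by one square-summable sequence is
    integrated coordinate by coordinate: when paired with a vector of [ell2] its
    partial sums are bounded by a constant, so dominated convergence applies. *)
Lemma is_ell2_integral_revint (tau K : R) (f : R -> nat -> R)
    (phi : nat -> R -> R) (beta : nat -> R) :
  0 < tau -> (forall k, continuous (phi k)) ->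
  (forall k (t : R), 0 <= t <= tau -> `|phi k t| <= K * `|beta k|) ->
  ell2 beta ->
  (forall s : R, 0 < s < tau -> forall k, f s k = phi k (tau - s)) ->
  is_ell2_integral `]0, tau[ f (fun k => revint tau (phi k)).
Proof.
move=> tau0 cphi bphi ebeta fphi.
have bf s k : `]0%R, tau[%classic s -> `|f s k| <= K * `|beta k|.
  rewrite /= in_itv /= => st; rewrite fphi //; apply: bphi; lra.
split.
- by move=> s Ds; apply: ell2_le ebeta => k; exact: bf.
- apply: (@ell2_le _ _ beta (K * tau)) => // k.
  rewrite mulrAC; apply: revint_bound => //; exact: bphi.
move=> v ev.
have [C hC] := ell2_prod_bounded ebeta ev.
pose S n s := \sum_(k < n) (f s k * v k).
have K0 : exists2 K' : R, 0 <= K' & K <= K'.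
  by exists `|K|; [exact: normr_ge0|exact: ler_norm].
case: K0 => K' K'0 KK'.
have absum s n : `]0%R, tau[%classic s -> \sum_(k < n) `|f s k * v k| <= K' * C.
  move=> Ds; apply: (le_trans _ (ler_wpM2l K'0 (hC n))).
  rewrite mulr_sumr; apply: ler_sum => k _; rewrite normrM mulrA.
  apply: ler_wpM2r => //; apply: (le_trans (bf s k Ds)).
  exact: ler_wpM2r.
have cvS s : `]0%R, tau[%classic s -> S ^~ s @ \oo --> ell2_ip (f s) v.
  move=> Ds; have := @cvg_series_bounded _ (fun k => f s k * v k) _ (fun n => absum s n Ds).
  by rewrite /ell2_ip /series; under eq_fun do rewrite big_mkord.
have cpv k : continuous (fun t => phi k t * v k).
  by move=> t; apply: cvgMl; exact: cphi.
have SE n s : `]0%R, tau[%classic s -> S n s = \sum_(k < n) (phi k (tau - s) * v k).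
  by rewrite /= in_itv /= => st; apply: eq_bigr => k _; rewrite fphi.
have iS n : mu.-integrable `]0, tau[ (EFin \o S n).
  apply: (@eq_integrable _ _ _ mu _ _
    (EFin \o (fun s => \sum_(k < n) (phi k (tau - s) * v k)))) => //.
    by move=> s /set_mem Ds /=; rewrite SE.
  apply: (@revint_integrable _ _ (fun t => \sum_(k < n) (phi k t * v k))).
  exact: (@revint_sum R tau n _ cpv).1.
have intS n : (\int[mu]_(s in `]0%R, tau[) (S n s)%:E)%E =
    (\sum_(k < n) (revint tau (phi k) * v k))%:E.
  rewrite -(fineK (integrable_fin_num _ (iS n))) //; congr EFin.
  transitivity (\int[mu]_(s in `]0, tau[) \sum_(k < n) (phi k (tau - s) * v k)).
    by apply: eq_Rintegral => s /set_mem Ds; exact: SE.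
  rewrite -[LHS]/(revint tau (fun t => \sum_(k < n) (phi k t * v k))).
  rewrite (@revint_sum R tau n _ cpv).2; apply: eq_bigr => k _.
  by rewrite mulrC -revintZ //; congr revint; apply/funext => t; rewrite mulrC.
have cvE s : `]0%R, tau[%classic s ->
    (fun n => (S n s)%:E) @ \oo --> (ell2_ip (f s) v)%:E.
  by move=> Ds; apply: cvg_EFin; [exact: nearW|exact: cvS].
have mS n := measurable_int mu (iS n).
have mlim := emeasurable_fun_cvg (fun n => EFin \o S n) _ mS cvE.
have [|||||intf _ lim] := @dominated_convergence _ _ R mu `]0, tau[
  (measurable_itv _) (fun n s => (S n s)%:E) (fun s => (ell2_ip (f s) v)%:E)
  (cst (K' * C)%:E).
- exact: mS.
- exact: mlim.
- by apply: aeW => s Ds; exact: cvE.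
- apply: (@integrableS _ _ _ mu `[0, tau]) => //; first exact: subset_itv_oo_cc.
  apply: continuous_compact_integrable; first exact: segment_compact.
  by apply: continuous_subspaceT => x; exact: cvg_cst.
- apply: aeW => s n Ds; rewrite /= lee_fin.
  by apply: (le_trans (ler_norm_sum _ _ _)); exact: absum.
split=> //.
apply: cvg_lim => //.
have := lim; rewrite -(fineK (integrable_fin_num _ intf)) // => /fine_cvg.
apply: cvg_trans; apply: near_eq_cvg; apply: nearW => n /=.
by rewrite intS /series /= big_mkord.
Qed.

End TermwiseIntegration.

(** * Small Hilbert-Schmidt perturbations and sums over frequency gaps *)

Section NearIdentity.
Context {R : realType}.

Lemma sum_CauchySchwarz n (x y : nat -> R) :
  (\sum_(j < n) x j * y j) ^+ 2 <= (\sum_(j < n) x j ^+ 2) * (\sum_(j < n) y j ^+ 2).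
Proof.
elim: n => [|n IH]; first by rewrite !big_ord0 expr0n mul0r.
rewrite !big_ord_recr /=.
have X0 : 0 <= \sum_(j < n) x j ^+ 2 by apply: sumr_ge0 => i _; exact: sqr_ge0.
have Y0 : 0 <= \sum_(j < n) y j ^+ 2 by apply: sumr_ge0 => i _; exact: sqr_ge0.
move: IH X0 Y0; move: (\sum_(j < n) x j * y j) (\sum_(j < n) x j ^+ 2)
  (\sum_(j < n) y j ^+ 2) (x n) (y n) => S X Y a b IH X0 Y0.
set A := X * b ^+ 2 + Y * a ^+ 2.
have A0 : 0 <= A by rewrite addr_ge0 // mulr_ge0 // sqr_ge0.
have AS : (2 * S * (a * b)) ^+ 2 <= A ^+ 2.
  have h : S ^+ 2 * (a * b) ^+ 2 <= X * Y * (a * b) ^+ 2.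
    by rewrite ler_wpM2r // sqr_ge0.
  have := sqr_ge0 (X * b ^+ 2 - Y * a ^+ 2); rewrite /A; nra.
have h : 2 * S * (a * b) <= A.
  rewrite (le_trans (ler_norm _)) // -(ler_pXn2r (ltn0Sn 1)) ?nnegrE //.
  by rewrite real_normK // num_real.
rewrite /A in h; nra.
Qed.

(** The Hilbert-Schmidt bound makes [E] a contraction by [1/2], so [I + E] has no
    kernel on any section, and the solution has norm at most twice that of [c].
    The second conclusion concerns every row [k], also those outside the section,
    and its bound depends on the section only through [c]. *)
Lemma near_identity_solve (E : nat -> nat -> R) (c : nat -> R) (N : nat) :
  (forall M, \sum_(k < M) \sum_(j < M) E k j ^+ 2 <= 1 / 4) ->
  exists a : nat -> R,
    (forall k, (k < N)%N -> a k + \sum_(j < N) E k j * a j = c k) /\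
    (forall k, (\sum_(j < N) E k j * a j) ^+ 2 <= \sum_(j < N) c j ^+ 2).
Proof.
move=> hE.
have rowE k : \sum_(j < N) E k j ^+ 2 <= 1 / 4.
  (* One row is part of a square section large enough to contain it. *)
  pose M := maxn k.+1 N.
  have kM : (k < M)%N by rewrite leq_max leqnn.
  apply: le_trans (hE M); rewrite (bigD1 (Ordinal kM)) //=.
  apply: (@le_trans _ _ (\sum_(j < M) E k j ^+ 2)).
    rewrite -(big_mkord xpredT (fun j => E k j ^+ 2)).
    rewrite -(big_mkord xpredT (fun j => E k j ^+ 2)).
    rewrite (big_cat_nat (leq0n N) (leq_maxr k.+1 N)) /= lerDl.
    by apply: sumr_ge0 => j _; exact: sqr_ge0.
  by rewrite lerDl; apply: sumr_ge0 => i _; apply: sumr_ge0 => j _; exact: sqr_ge0.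
have contr (a : nat -> R) :
    \sum_(k < N) (\sum_(j < N) E k j * a j) ^+ 2 <= 1 / 4 * \sum_(j < N) a j ^+ 2.
  apply: (@le_trans _ _ ((\sum_(k < N) \sum_(j < N) E k j ^+ 2) * \sum_(j < N) a j ^+ 2)).
    by rewrite mulr_suml; apply: ler_sum => k _; exact: sum_CauchySchwarz.
  by apply: ler_wpM2r => //; apply: sumr_ge0 => j _; exact: sqr_ge0.
pose G := (\matrix_(j < N, k < N) ((j == k)%:R + E k j)) : 'M[R]_N.
(* Row vectors are extended by 0 to sequences, so that [contr] applies. *)
pose ext (v : 'rV[R]_N) (j : nat) := if insub j is Some i then v 0 i else 0.
have extE (v : 'rV[R]_N) (j : 'I_N) : ext v j = v 0 j by rewrite /ext valK.
have GE (v : 'rV[R]_N) (k : 'I_N) :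
    (v *m G) 0 k = ext v k + \sum_(j < N) E k j * ext v j.
  rewrite mxE.
  under eq_bigr => j _ do rewrite mxE mulrDr.
  rewrite big_split /= (bigD1 k) //= eqxx mulr1 big1 ?addr0; last first.
    by move=> j /negbTE ->; rewrite mulr0.
  rewrite extE; congr (_ + _); apply: eq_bigr => j _; by rewrite extE mulrC.
have Gu : G \in unitmx.
  rewrite -row_free_unit -kermx_eq0; apply/eqP/row_matrixP => i.
  rewrite row0; set v := row i _.
  have vG : v *m G = 0 by rewrite /v -row_mul mulmx_ker row0.
  have vE (k : 'I_N) : ext v k ^+ 2 = (\sum_(j < N) E k j * ext v j) ^+ 2.
    have := GE v k; rewrite vG mxE => /eqP; rewrite eq_sym addr_eq0 => /eqP ->.
    by rewrite sqrrN.
  have := contr (ext v).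
  rewrite -(eq_bigr _ (fun k _ => vE k)) => h.
  have s0 : \sum_(j < N) ext v j ^+ 2 = 0.
    have : 0 <= \sum_(j < N) ext v j ^+ 2 by apply: sumr_ge0 => j _; exact: sqr_ge0.
    move: (\sum_(j < N) ext v j ^+ 2) h => s h s0; lra.
  apply/rowP => k; rewrite [RHS]mxE -extE.
  have /psumr_eq0P := s0; move=> /(_ (fun j _ => sqr_ge0 _) k isT)/eqP.
  by rewrite sqrf_eq0 => /eqP.
pose a := ext ((\row_(k < N) c k) *m invmx G).
have aE k : (k < N)%N -> a k + \sum_(j < N) E k j * a j = c k.
  move=> kN; rewrite -(GE _ (Ordinal kN)) -mulmxA mulVmx // mulmx1 mxE //.
exists a; split=> // k.
have a4 : \sum_(j < N) a j ^+ 2 <= 4 * \sum_(j < N) c j ^+ 2.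
  have : \sum_(j < N) a j ^+ 2 <= 2 * \sum_(j < N) c j ^+ 2 +
     2 * \sum_(i < N) (\sum_(j < N) E i j * a j) ^+ 2.
    rewrite !mulr_sumr -big_split /=; apply: ler_sum => i _.
    rewrite -(aE _ (ltn_ord i)).
    move: (a i) (\sum_(j < N) _) => u w; have := sqr_ge0 (u + 2 * w); nra.
  have := contr a; lra.
apply: (le_trans (sum_CauchySchwarz N (E k) a)).
have := rowE k.
have : 0 <= \sum_(j < N) E k j ^+ 2 by apply: sumr_ge0 => j _; exact: sqr_ge0.
have : 0 <= \sum_(j < N) a j ^+ 2 by apply: sumr_ge0 => j _; exact: sqr_ge0.
nra.
Qed.

End NearIdentity.

Section FrequencySums.
Context {R : realType}.

Lemma sum_half (F : nat -> R) n :
  \sum_(k < n.*2) F k./2 = 2 * \sum_(i < n) F i.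
Proof.
elim: n => [|n IH]; first by rewrite !big_ord0 mulr0.
rewrite doubleS !big_ord_recr /= IH uphalf_double doubleK; ring.
Qed.

Lemma sum_half_le (F : nat -> R) n : (forall i, 0 <= F i) ->
  \sum_(k < n) F k./2 <= 2 * \sum_(i < n) F i.
Proof.
move=> F0; rewrite -sum_half -addnn.
rewrite -(big_mkord xpredT (fun k => F k./2)) -(big_mkord xpredT (fun k => F k./2)).
rewrite (big_cat_nat (leq0n n) (leq_addr n n)) /= lerDl.
by apply: sumr_ge0 => j _; exact: F0.
Qed.

Variable omega : nat -> R.
Hypothesis homega_pos : forall n, (0 < n)%N -> 0 < omega n.
Hypothesis homega_inj : forall i j, (0 < i)%N -> (0 < j)%N -> i != j ->
    omega i != omega j.
Hypothesis homega_sum : (\esum_(p in [set p : nat * nat |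
      [/\ (0 < p.1)%N, (0 < p.2)%N & p.1 != p.2]])
      (1 / (omega p.1 - omega p.2) ^+ 2)%:E < +oo)%E.

(** The unconditional sum over pairs, restricted to a square of indices.  The diagonal
    may be kept because the inverse of [0] is [0]. *)
Lemma gap_sums_bounded : exists2 S : R, 0 <= S & forall n,
  \sum_(i < n) \sum_(j < n) (omega i.+1 - omega j.+1) ^- 2 <= S.
Proof.
have := homega_sum; set A := [set p : nat * nat | _]; set s := esum _ _ => hs.
have s0 : (0 <= s)%E.
  by apply: esum_ge0 => p _; rewrite lee_fin divr_ge0 // sqr_ge0.
have sf : s \is a fin_num by rewrite ge0_fin_numE.
exists (fine s); first exact: fine_ge0.
move=> n; rewrite -lee_fin fineK // pair_big /=.
rewrite (bigID (fun p : 'I_n * 'I_n => p.1 == p.2)) /= big1 ?add0r; last first.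
  by move=> p /eqP ->; rewrite subrr expr0n invr0.
rewrite -sumEFin.
pose f (p : 'I_n * 'I_n) : nat * nat := (p.1.+1, p.2.+1).
have finj : injective f.
  by case=> [i j] [k l] [/val_inj -> /val_inj ->].
pose X := [fset f p | p in [pred p : 'I_n * 'I_n | p.1 != p.2]]%fset.
apply: (@esum_ge R _ A); exists [set` X].
  split; first exact: finite_fset.
  move=> p /= /imfsetP[[i j] /= ij ->].
  by split => //=; rewrite eqSS.
rewrite fsbig_finite //= set_fsetK.
rewrite big_imfset /=; last by move=> p q _ _; exact: finj.
rewrite big_enum_cond /=.
rewrite le_eqVlt; apply/orP; left; apply/eqP.
by apply: eq_big => [p|p _]; rewrite ?andbT // div1r.
Qed.

(** The gaps have a positive lower bound [d], since each inverse square is at most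
    their sum.  Two frequencies below [d] would be closer than [d], so at most one
    of them lies there. *)
Lemma frequencies_lower_bound : exists2 m : R, 0 < m &
  forall n, (0 < n)%N -> m <= omega n.
Proof.
have [S S0 hS] := gap_sums_bounded.
have gap i j : (0 < i)%N -> (0 < j)%N -> i != j ->
    (omega i - omega j) ^- 2 <= S.
  case: i j => [//|i] [//|j] _ _ ij.
  pose n := (maxn i j).+1.
  have iN : (i < n)%N by rewrite ltnS leq_maxl.
  have jN : (j < n)%N by rewrite ltnS leq_maxr.
  have pos k l : 0 <= (omega k - omega l) ^- 2 by rewrite invr_ge0 sqr_ge0.
  apply: le_trans (hS n); rewrite (bigD1 (Ordinal iN)) //= (bigD1 (Ordinal jN)) //=.
  rewrite -addrA lerDl addr_ge0 ?sumr_ge0 // => k _.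
  by rewrite sumr_ge0.
(* [d ^- 2 = (S + 1) ^ 2] exceeds [S], the bound on all inverse square gaps. *)
pose d := (S + 1)^-1.
have d0 : 0 < d by rewrite invr_gt0; lra.
have far i j : (0 < i)%N -> (0 < j)%N -> i != j -> d <= `|omega i - omega j|.
  move=> i0 j0 ij; have := gap _ _ i0 j0 ij.
  have nz : 0 < `|omega i - omega j| by rewrite normr_gt0 subr_eq0 homega_inj.
  rewrite -(real_normK (num_real (omega i - omega j))) -exprVn /d => h.
  rewrite -[leRHS]invrK lef_pV2 ?posrE ?invr_gt0 //; last lra.
  have : 0 < `|omega i - omega j|^-1 by rewrite invr_gt0.
  nra.
case: (pselect (exists2 n, (0 < n)%N & omega n < d)) => [[k k0 kd]|nk].
  exists (omega k); first exact: homega_pos.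
  move=> n n0; have [->//|nk] := eqVneq n k.
  rewrite leNgt; apply/negP => nlt.
  have := far n k n0 k0 nk; rewrite leNgt => /negP; apply.
  rewrite distrC ger0_norm; last lra.
  have := homega_pos n0; lra.
exists d => // n n0; rewrite leNgt; apply/negP => nd.
by apply: nk; exists n.
Qed.

(** Comparison with the gaps to the first frequency: since the frequencies are
    bounded below by some [m], [(omega_k - omega_1)^2] is at most
    [(1 + omega_1^2 / m^2) omega_k^2]. *)
Lemma inverse_square_sums_bounded : exists2 Q : R, 0 <= Q & forall n,
  \sum_(i < n) omega i.+1 ^- 2 <= Q.
Proof.
have [S S0 hS] := gap_sums_bounded.
have [m m0 hm] := frequencies_lower_bound.
pose C := 1 + omega 1 ^+ 2 / m ^+ 2.
have C0 : 0 <= C by rewrite addr_ge0 // divr_ge0 // sqr_ge0.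
have w0 k : 0 < omega k.+1 by exact: homega_pos.
have i0 (x : R) : 0 <= x ^- 2 by rewrite invr_ge0 sqr_ge0.
exists (omega 1 ^- 2 + C * S); first by rewrite addr_ge0 // mulr_ge0.
move=> n; case: n => [|n]; first by rewrite big_ord0 addr_ge0 // mulr_ge0.
rewrite big_ord_recl; apply: lerD => //.
apply: le_trans (ler_wpM2l C0 (hS n.+1)).
apply: (@le_trans _ _ (C * \sum_(k < n) (omega k.+2 - omega 1) ^- 2)); last first.
  rewrite ler_wpM2l // big_ord_recl.
  apply: (@le_trans _ _ (\sum_(k < n.+1) (omega 1 - omega k.+1) ^- 2)).
    rewrite big_ord_recl; apply: (@le_trans _ _ (\sum_(k < n) (omega 1 - omega k.+2) ^- 2)).
      by apply: ler_sum => k _; rewrite -(sqrrN (omega k.+2 - _)) opprB.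
    by rewrite lerDr.
  by rewrite lerDl; apply: sumr_ge0 => k _; exact: sumr_ge0.
rewrite mulr_sumr; apply: ler_sum => k _.
have x0 : 0 < omega k.+2 ^+ 2 by rewrite exprn_gt0.
have xy0 : 0 < (omega k.+2 - omega 1) ^+ 2.
  by rewrite lt0r sqrf_eq0 subr_eq0 homega_inj //= sqr_ge0.
rewrite ler_pdivlMr // mulrC ler_pdivrMr // /C.
have h : omega 1 ^+ 2 <= omega 1 ^+ 2 / m ^+ 2 * omega k.+2 ^+ 2.
  rewrite -mulrA ler_peMr ?sqr_ge0 // mulrC ler_pdivlMr ?exprn_gt0 // mul1r.
  by apply: lerXn2r; [rewrite nnegrE ltW|rewrite nnegrE ltW|exact: hm].
have := mulr_ge0 (ltW (w0 0%N)) (ltW (w0 k.+1)).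
rewrite mulrDl mul1r; lra.
Qed.

(** The zeroth block is given frequency [0], so that the gap between it and the
    [n]-th block is [omega n]. *)
Definition padded_freq (n : nat) : R := if n == 0%N then 0 else omega n.

(** The squares of the expected sizes of the pairing errors.  With the convention
    that the inverse of [0] is [0], only the second term contributes on the
    diagonal, and the weight of the zeroth block with itself is [0]. *)
Definition sqr_gap_weight (n k : nat) : R :=
  (padded_freq n - padded_freq k) ^- 2 + (n == k)%:R * padded_freq n ^- 2.

Lemma weight_sums_bounded : exists2 W : R, 0 <= W & forall n,
  \sum_(i < n) \sum_(j < n) sqr_gap_weight i j <= W.
Proof.
have [S S0 hS] := gap_sums_bounded.
have [Q Q0 hQ] := inverse_square_sums_bounded.
have W0 : 0 <= S + Q + Q + Q by lra.
exists (S + Q + Q + Q) => // -[|n]; first by rewrite big_ord0.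
have row0 : \sum_(j < n.+1) sqr_gap_weight 0 j = \sum_(j < n) omega j.+1 ^- 2.
  rewrite big_ord_recl /sqr_gap_weight /padded_freq /= subrr expr0n /= invr0 mulr0 addr0 add0r.
  by apply: eq_bigr => j _; rewrite mul0r addr0 sub0r sqrrN.
have rowS (i : 'I_n) : \sum_(j < n.+1) sqr_gap_weight i.+1 j =
    omega i.+1 ^- 2 + omega i.+1 ^- 2 +
    \sum_(j < n) (omega i.+1 - omega j.+1) ^- 2.
  rewrite big_ord_recl /sqr_gap_weight /padded_freq /= subr0 mul0r addr0 -addrA; congr (_ + _).
  rewrite big_split /= addrC; congr (_ + _).
  rewrite (bigD1 i) //= eqxx mul1r big1 ?addr0 // => j ji.
  rewrite /bump /= !add1n eqSS.
  by case: eqP => [/val_inj ij|_]; [rewrite ij eqxx in ji|rewrite mul0r].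
rewrite big_ord_recl row0 (eq_bigr _ (fun i _ => rowS i)) !big_split /=.
have := hS n; have := hQ n; lra.
Qed.

End FrequencySums.

(** * Nearly biorthogonal families *)

Section NearBiorthogonality.
Context {R : realType}.
Variables (tau kap : R) (mu : nat -> R).
Hypothesis tau0 : 0 < tau.
Hypothesis kap0 : 0 <= kap.
Hypothesis ktau : kap * tau <= 1 / 2.

(** A sine is a cosine with phase [- pi / 2], which lets both coordinates of a block
    be treated by one formula. *)
Definition phase (k : nat) : R := if odd k then 0 else - (pi / 2).

Definition osc_mode (k : nat) (t : R) : R := cos (mu k./2 * t + phase k).

Definition test_mode (k : nat) (t : R) : R :=
  if k./2 == 0%N then (if odd k then 1 else t / tau)
  else expR (- kap * t) * osc_mode k t.

(** The two affine functions are the ones biorthogonal to [t / tau] and [1] on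
    [[0, tau]].  The factor [exp (kap t)] cancels the damping of the test
    functions, so that pairings of oscillating modes are exact cosine integrals. *)
Definition dual_mode (k : nat) (t : R) : R :=
  if k./2 == 0%N then
    (if odd k then (4 - 6 * (t / tau)) / tau else (12 * (t / tau) - 6) / tau)
  else 2 / tau * (expR (kap * t) * osc_mode k t).

Lemma is_derive_affine (p q x : R) : is_derive x 1 (fun t => p + q * t) q.
Proof.
apply: (is_derive_val_eq (is_derive_addf (is_derive_cst p x 1)
  (is_derive_scalef q (is_derive_id x (1 : R))))).
by rewrite add0r mulr1.
Qed.

Lemma is_derive_expRM (s x : R) :
  is_derive x 1 (fun t => expR (s * t)) (s * expR (s * x)).
Proof.
have -> : (fun t => expR (s * t)) = (fun t => expR (s * t + 0)).
  by apply/funext => t; rewrite addr0.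
by apply: (is_derive_val_eq (is_derive_comp_affine (is_derive_expR _))); rewrite addr0.
Qed.

Lemma continuous_osc_mode k : continuous (osc_mode k).
Proof.
move=> t; exact: is_derive_continuous (is_derive_comp_affine (is_derive_cos _)).
Qed.

Lemma continuous_test_mode k : continuous (test_mode k).
Proof.
rewrite /test_mode; case: (k./2 == 0%N).
  case: odd => t; first exact: cvg_cst.
  by apply: cvgMl; exact: cvg_id.
move=> t; apply: cvgM; last exact: continuous_osc_mode.
exact: is_derive_continuous (is_derive_expRM _ _).
Qed.

Lemma dual_mode_affine k : (k./2 == 0)%N -> exists p q : R,
  (forall t, dual_mode k t = p + q * t) /\ `|q| <= 12 / tau ^+ 2 /\
  forall t, 0 <= t <= tau -> `|p + q * t| <= 6 / tau.
Proof.
move=> k2; rewrite /dual_mode k2.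
have t0 : tau != 0 by exact: lt0r_neq0.
have tt (t : R) : 0 <= t <= tau -> 0 <= t / tau <= 1.
  move=> /andP[t0' t1]; apply/andP; split; first by apply: divr_ge0 => //; exact: ltW.
  by rewrite ler_pdivrMr // mul1r.
have tV : 0 <= tau ^- 2 by rewrite invr_ge0 sqr_ge0.
have tV1 : 0 <= tau^-1 by rewrite invr_ge0 ltW.
case: (odd k).
  exists (4 / tau), (- (6 / tau ^+ 2)); split; [|split].
  - by move=> t; field.
  - rewrite normrN normrM ger0_norm // ger0_norm //; nra.
  - move=> t /tt h.
    rewrite (_ : 4 / tau + - (6 / tau ^+ 2) * t = (4 - 6 * (t / tau)) / tau); last by field.
    rewrite normrM (ger0_norm tV1) ler_wpM2r // ler_norml; lra.
exists (- 6 / tau), (12 / tau ^+ 2); split; [|split].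
- by move=> t; field.
- by rewrite normrM ger0_norm // ger0_norm.
- move=> t /tt h.
  rewrite (_ : - 6 / tau + 12 / tau ^+ 2 * t = (12 * (t / tau) - 6) / tau); last by field.
  rewrite normrM (ger0_norm tV1) ler_wpM2r // ler_norml; lra.
Qed.

Lemma continuous_dual_mode k : continuous (dual_mode k).
Proof.
case: (boolP (k./2 == 0%N)) => [k2|/negbTE k2].
  have [p [q [E _]]] := dual_mode_affine k2.
  rewrite (_ : dual_mode k = fun t => p + q * t); last exact/funext.
  by move=> t; exact: is_derive_continuous (is_derive_affine _ _ _).
rewrite /dual_mode k2 => t; apply: cvgMr; apply: cvgM; last exact: continuous_osc_mode.
exact: is_derive_continuous (is_derive_expRM _ _).
Qed.

(** Integration by parts with [h t = (p + q t) exp (s t)]; since [|s| tau <= 1/2]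
    the exponential is at most [2], which gives [|h| <= 12 / tau] and
    [|h'| <= 30 / tau ^ 2]. *)
Lemma revint_affine_exp_osc (p q s nu th : R) : nu != 0 -> `|s| * tau <= 1 / 2 ->
  `|q| <= 12 / tau ^+ 2 ->
  (forall t, 0 <= t <= tau -> `|p + q * t| <= 6 / tau) ->
  `|revint tau (fun t => (p + q * t) * expR (s * t) * cos (nu * t + th))|
    <= 54 / tau / `|nu|.
Proof.
move=> nu0 st qb pb.
have t0 : tau != 0 by exact: lt0r_neq0.
have e2 (t : R) : 0 <= t <= tau -> expR (s * t) <= 2.
  move=> /andP[t0' tt].
  have h : s * t <= 1 / 2.
    apply: le_trans st; apply: (le_trans (ler_norm _)).
    by rewrite normrM (ger0_norm t0') ler_wpM2l.
  (* [exp (- x) >= 1 - x >= 1/2] for [x <= 1/2]. *)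
  have h1 := expR_ge1Dx (- (s * t)).
  have h2 : 1 / 2 <= expR (- (s * t)) by lra.
  rewrite expRN in h2; have e0 := expR_gt0 (s * t).
  by rewrite -[2]invrK -[expR _]invrK lef_pV2 ?posrE ?invr_gt0 // -[2^-1]mul1r.
have dh (t : R) := is_derive_mulf (is_derive_affine p q t) (is_derive_expRM s t).
have ch' : continuous (fun t => (p + q * t) * (s * expR (s * t)) + q * expR (s * t)).
  have ce (t : R) := is_derive_continuous (is_derive_expRM s t).
  move=> t; apply: cvgD; last by apply: cvgMr; exact: ce.
  apply: cvgM; last by apply: cvgMr; exact: ce.
  exact: is_derive_continuous (is_derive_affine _ _ _).
have := @revint_osc _ _ tau0 _ _ nu th (12 / tau) (30 / tau ^+ 2) nu0 ch' dh.
have -> : 54 / tau = 2 * (12 / tau) + tau * (30 / tau ^+ 2) by field.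
apply=> t tt; rewrite ?normrM.
  rewrite (_ : 12 / tau = 6 / tau * 2); last by field.
  by apply: ler_pM; rewrite ?pb // ger0_norm ?expR_ge0 // e2.
rewrite (_ : _ + _ = ((p + q * t) * s + q) * expR (s * t)); last by ring.
rewrite normrM (_ : 30 / tau ^+ 2 = 15 / tau ^+ 2 * 2); last by field.
apply: ler_pM; rewrite ?(ger0_norm (expR_ge0 _)) ?expR_ge0 ?e2 //.
apply: (le_trans (ler_normD _ _)).
rewrite (_ : 15 / tau ^+ 2 = 6 / tau * ((1 / 2) / tau) + 12 / tau ^+ 2); last by field.
apply: lerD => //; rewrite normrM; apply: ler_pM => //; first exact: pb.
by rewrite ler_pdivlMr.
Qed.

Variable omega : nat -> R.
Hypothesis omega0 : forall n, (0 < n)%N -> 0 < omega n.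
Hypothesis omega_mu : forall n, (0 < n)%N -> omega n / 2 <= mu n.
Hypothesis gap_mu : forall n m, (0 < n)%N -> (0 < m)%N -> n != m ->
  0 < `|omega n - omega m| <= `|mu n - mu m|.

Definition gram_error (k j : nat) : R :=
  revint tau (fun t => test_mode k t * dual_mode j t) - (k == j)%:R.

Lemma sqr_le_weight (x c w : R) : 0 < w -> `|x| <= c / w ->
  x ^+ 2 <= c ^+ 2 * w ^- 2.
Proof.
move=> w0 xc; rewrite -(real_normK (num_real x)) -expr_div_n.
by apply: lerXn2r => //; rewrite nnegrE // (le_trans (normr_ge0 _) xc).
Qed.

(** The pairings are integrals of polynomials of degree at most two. *)
Lemma gram_error_polynomial k j : (k./2 == 0)%N -> (j./2 == 0)%N ->
  gram_error k j = 0.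
Proof.
have t0 : tau != 0 by exact: lt0r_neq0.
have I (a b c : R) : revint tau (fun t => a + b * t + c * (t * t)) =
    a * tau + b * tau ^+ 2 / 2 + c * tau ^+ 3 / 3.
  have dF (t : R) : is_derive t 1 (fun t => a * t + b / 2 * t ^+ 2 + c / 3 * t ^+ 3)
      (a + b * t + c * (t * t)).
    apply: (is_derive_val_eq (is_derive_addf (is_derive_addf (is_derive_scalef a
      (is_derive_id t (1 : R)))
       (is_derive_scalef (b / 2) (is_derive_exprn 1 t)))
       (is_derive_scalef (c / 3) (is_derive_exprn 2 t)))).
    by field.
  rewrite (revint_FTC tau0 _ dF); first by field.
  move=> t; apply: cvgD; last by apply: cvgMr; apply: cvgM; exact: cvg_id.
  exact: is_derive_continuous (is_derive_affine _ _ _).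
have small (i : nat) : (i./2 == 0)%N -> i = odd i :> nat.
  by move=> /eqP i2; rewrite -[LHS]odd_double_half i2 addn0.
move=> k2 j2; rewrite /gram_error /test_mode /dual_mode k2 j2
  [in k == j](small k k2) [in _ == j](small j j2).
case: (odd k); case: (odd j) => /=.
- rewrite (_ : (fun t => _) = fun t => 4 / tau + - (6 / tau ^+ 2) * t + 0 * (t * t)).
    by rewrite I; field.
  by apply/funext => t; field.
- rewrite (_ : (fun t => _) = fun t => - 6 / tau + (12 / tau ^+ 2) * t + 0 * (t * t)).
    by rewrite I; field.
  by apply/funext => t; field.
- rewrite (_ : (fun t => _) = fun t => 0 + (4 / tau ^+ 2) * t + - (6 / tau ^+ 3) * (t * t)).
    by rewrite I; field.
  by apply/funext => t; field.
- rewrite (_ : (fun t => _) = fun t => 0 + - (6 / tau ^+ 2) * t + (12 / tau ^+ 3) * (t * t)).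
    by rewrite I; field.
  by apply/funext => t; field.
Qed.

Lemma revint_cos (nu th : R) : nu != 0 ->
  `|revint tau (fun t => cos (nu * t + th))| <= 2 / `|nu|.
Proof.
move=> nu0.
have := @revint_osc _ _ tau0 (cst 1) (cst 0) nu th 1 0 nu0.
rewrite mulr0 addr0 mulr1.
rewrite (_ : (fun t => cst 1 t * _) = fun t => cos (nu * t + th)); last first.
  by apply/funext => t; rewrite mul1r.
apply.
- by move=> t; exact: cvg_cst.
- by move=> t _; rewrite normr1.
- by move=> t _; rewrite normr0.
Qed.

Lemma continuous_cos_affine (nu th : R) : continuous (fun t => cos (nu * t + th)).
Proof.
move=> t; exact: is_derive_continuous (is_derive_comp_affine (is_derive_cos _)).
Qed.

Lemma cos_mul_cos (a b : R) : 2 * (cos a * cos b) = cos (a - b) + cos (a + b).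
Proof. by rewrite cosB cosD; ring. Qed.

(** The exponentials cancel, and the product of two cosines is split into a
    difference and a sum frequency. *)
Lemma gram_osc k j : (k./2 == 0)%N = false -> (j./2 == 0)%N = false ->
  revint tau (fun t => test_mode k t * dual_mode j t) = 1 / tau *
    (revint tau (fun t => cos ((mu k./2 - mu j./2) * t + (phase k - phase j))) +
     revint tau (fun t => cos ((mu k./2 + mu j./2) * t + (phase k + phase j)))).
Proof.
move=> k2 j2; rewrite /test_mode /dual_mode k2 j2.
rewrite -revintD //; try exact: continuous_cos_affine.
rewrite -revintZ; last first.
  by move=> t; apply: cvgD; exact: continuous_cos_affine.
congr revint; apply/funext => t.
have e1 : expR (- kap * t) * expR (kap * t) = 1 by rewrite -expRD mulNr addNr expR0.
rewrite (_ : _ * _ = (expR (- kap * t) * expR (kap * t)) / tau *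
   (2 * (osc_mode k t * osc_mode j t))); last by ring.
rewrite e1 cos_mul_cos; congr (_ * (cos _ + cos _)); ring.
Qed.

(** Both the difference and the sum of two damped frequencies are at least the gap
    [|omega_n - omega_m|].  Within one block the difference frequency vanishes, and
    its integral gives exactly the Kronecker symbol, by orthogonality of the two
    phases; the sum frequency contributes the error. *)
Lemma gram_error_osc k j : (0 < k./2)%N -> (0 < j./2)%N ->
  gram_error k j ^+ 2 <= (4 / tau) ^+ 2 * sqr_gap_weight omega k./2 j./2.
Proof.
move=> k0 j0; have tV : 0 < tau^-1 by rewrite invr_gt0.
have kz : (k./2 == 0)%N = false by apply/negbTE; rewrite -lt0n.
have jz : (j./2 == 0)%N = false by apply/negbTE; rewrite -lt0n.
have mk := omega_mu k0; have mj := omega_mu j0.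
have ok := omega0 k0; have oj := omega0 j0.
rewrite /gram_error gram_osc // /sqr_gap_weight /padded_freq kz jz.
set A := revint _ _; set B := revint _ _.
have Bb : `|B| <= 2 / (mu k./2 + mu j./2).
  rewrite -[X in _ / X]ger0_norm; last lra.
  by apply: revint_cos; rewrite lt0r_neq0 //; lra.
have [kj|kj] := eqVneq k./2 j./2; last first.
  have /andP[g0 g] := gap_mu k0 j0 kj.
  rewrite (_ : (k == j) = false); last first.
    by apply/negP => /eqP E; rewrite E eqxx in kj.
  rewrite mul0r addr0 subr0 -(real_normK (num_real (_ - omega _))).
  apply: sqr_le_weight => //.
  have Ab : `|A| <= 2 / `|mu k./2 - mu j./2|.
    by apply: revint_cos; rewrite -normr_gt0; exact: lt_le_trans g.
  have b1 : 2 / `|mu k./2 - mu j./2| <= 2 / `|omega k./2 - omega j./2|.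
    by rewrite ler_pM2l // lef_pV2 // posrE //; exact: lt_le_trans g.
  have b2 : 2 / (mu k./2 + mu j./2) <= 2 / `|omega k./2 - omega j./2|.
    rewrite ler_pM2l // lef_pV2 ?posrE //; last lra.
    by apply: (le_trans g); rewrite ler_norml; lra.
  rewrite normrM (@ger0_norm _ (1 / tau)); last by rewrite div1r ltW.
  have h : `|A + B| <= 4 / `|omega k./2 - omega j./2|.
    by apply: (le_trans (ler_normD _ _)); lra.
  apply: (le_trans (ler_wpM2l _ h)); first by rewrite div1r ltW.
  by rewrite le_eqVlt; apply/orP; left; apply/eqP; ring.
have AE : A = (k == j)%:R * tau.
  rewrite /A kj subrr -[RHS]subr0 -[X in _ = _ - X](mulr0 (k == j)%:R).
  apply: (revint_FTC tau0 (F := fun t => (k == j)%:R * t)).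
    exact: continuous_cos_affine.
  move=> t; apply: (is_derive_val_eq (is_derive_scalef _ (is_derive_id t (1 : R)))).
  rewrite mulr1 mul0r add0r /phase.
  have -> : (k == j) = (odd k == odd j).
    apply/eqP/eqP => [->//|okj].
    by rewrite -[k]odd_double_half -[j]odd_double_half kj okj.
  by case: (odd k); case: (odd j);
    rewrite ?subrr ?cos0 ?subr0 ?sub0r ?opprK ?cosN ?cos_pihalf.
rewrite -kj subrr expr0n /= invr0 add0r !mul1r.
have -> : tau^-1 * (A + B) - (k == j)%:R = B / tau.
  by rewrite AE; field; exact: lt0r_neq0.
apply: sqr_le_weight => //.
rewrite normrM (gtr0_norm tV) mulrAC ler_pM2r //.
apply: (le_trans Bb).
rewrite ler_pdivlMr // mulrAC ler_pdivrMr; last lra.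
by rewrite -kj in mj *; lra.
Qed.

Lemma gram_error_left k j : (k./2 == 0)%N -> (0 < j./2)%N ->
  gram_error k j ^+ 2 <= (108 / tau) ^+ 2 * sqr_gap_weight omega k./2 j./2.
Proof.
move=> /eqP k0 j0; have jz : (j./2 == 0)%N = false by apply/negbTE; rewrite -lt0n.
have mj := omega_mu j0; have oj := omega0 j0.
have tV : 0 < tau^-1 by rewrite invr_gt0.
have kj : (k == j) = false by apply/eqP => E; rewrite -E k0 in j0.
rewrite /gram_error kj subr0 /sqr_gap_weight k0 /padded_freq /=
  jz eq_sym jz mul0r addr0 sub0r sqrrN.
apply: sqr_le_weight => //.
(* Both test functions of the zeroth block are affine: [1] and [t / tau]. *)
pose p : R := if odd k then 2 / tau else 0; pose q : R := if odd k then 0 else 2 / tau ^+ 2.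
rewrite (_ : (fun t => _) = fun t => (p + q * t) * expR (kap * t) *
    cos (mu j./2 * t + phase j)); last first.
  apply/funext => t; rewrite /test_mode /dual_mode k0 jz /= /p /q /osc_mode.
  by case: (odd k); field; exact: lt0r_neq0.
have m0 : 0 < mu j./2 by lra.
have h := @revint_affine_exp_osc p q kap (mu j./2) (phase j).
apply: (@le_trans _ _ (54 / tau / `|mu j./2|)).
  apply: h; first exact: lt0r_neq0.
  - by rewrite ger0_norm.
  - rewrite /q; have : 0 <= tau ^- 2 by rewrite invr_ge0 sqr_ge0.
    by case: odd => h; rewrite ?normr0 ?ger0_norm; lra.
  - move=> t /andP[t0' tt]; rewrite /p /q; case: odd.
      by rewrite mul0r addr0 ger0_norm; lra.
    have h : t / tau <= 1 by rewrite ler_pdivrMr // mul1r.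
    have h' : 0 <= t / tau by rewrite divr_ge0 // ltW.
    rewrite (_ : 0 + _ = 2 * (t / tau) / tau); last by field; exact: lt0r_neq0.
    rewrite normrM (gtr0_norm tV) ler_pM2r // ger0_norm; lra.
rewrite gtr0_norm //.
rewrite mulrAC [leRHS]mulrAC ler_pM2r // ler_pdivlMr // mulrAC ler_pdivrMr //; lra.
Qed.

Lemma gram_error_right k j : (0 < k./2)%N -> (j./2 == 0)%N ->
  gram_error k j ^+ 2 <= (108 / tau) ^+ 2 * sqr_gap_weight omega k./2 j./2.
Proof.
move=> k0 jz; have j0 := eqP jz.
have kz : (k./2 == 0)%N = false by apply/negbTE; rewrite -lt0n.
have mk := omega_mu k0; have ok := omega0 k0.
have tV : 0 < tau^-1 by rewrite invr_gt0.
have kj : (k == j) = false by apply/eqP => E; rewrite E j0 in k0.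
rewrite /gram_error kj subr0 /sqr_gap_weight j0 /padded_freq /= kz mul0r addr0 subr0.
apply: sqr_le_weight => //.
have [p [q [dE [qb pb]]]] := dual_mode_affine jz.
rewrite (_ : (fun t => _) = fun t => (p + q * t) * expR (- kap * t) *
    cos (mu k./2 * t + phase k)); last first.
  by apply/funext => t; rewrite dE /test_mode kz /osc_mode; ring.
have m0 : 0 < mu k./2 by lra.
apply: (@le_trans _ _ (54 / tau / `|mu k./2|)).
  apply: revint_affine_exp_osc => //; first exact: lt0r_neq0.
  by rewrite normrN ger0_norm.
rewrite gtr0_norm //.
rewrite mulrAC [leRHS]mulrAC ler_pM2r // ler_pdivlMr // mulrAC ler_pdivrMr //; lra.
Qed.

Lemma sqr_gap_weight_ge0 n m : 0 <= sqr_gap_weight omega n m.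
Proof. by rewrite addr_ge0 ?mulr_ge0 // invr_ge0 sqr_ge0. Qed.

Lemma gram_error_le k j :
  gram_error k j ^+ 2 <= (108 / tau) ^+ 2 * sqr_gap_weight omega k./2 j./2.
Proof.
case: (posnP k./2) => [/eqP k0|k0]; case: (posnP j./2) => [/eqP j0|j0].
- rewrite gram_error_polynomial // expr0n /=.
  by rewrite mulr_ge0 ?sqr_ge0 // sqr_gap_weight_ge0.
- exact: gram_error_left.
- exact: gram_error_right.
apply: (le_trans (gram_error_osc k0 j0)); rewrite ler_wpM2r ?sqr_gap_weight_ge0 //.
have tV : 0 < tau^-1 by rewrite invr_gt0.
by apply: lerXn2r; rewrite ?nnegrE; nra.
Qed.

End NearBiorthogonality.

(** * Solving the moment problem *)

Section Controllability.
Context {R : realType}.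

Lemma sum_pairs (F : nat -> R) n :
  \sum_(k < n.*2) F k = \sum_(i < n) (F i.*2 + F i.*2.+1).
Proof.
elim: n => [|n IH]; first by rewrite !big_ord0.
by rewrite doubleS !big_ord_recr /= IH addrA.
Qed.

(** Each coordinate of a block-diagonal image is controlled by both coordinates of
    its block, and every block is used twice. *)
Lemma ell2_pairs (x : nat -> R) : ell2 x ->
  ell2 (fun k => `|x k./2.*2| + `|x k./2.*2.+1|).
Proof.
move=> ex.
have h n : \sum_(k < n) (`|x k./2.*2| + `|x k./2.*2.+1|) ^+ 2 <=
    4 * limn (series (fun n => x n ^+ 2)).
  apply: (le_trans (@sum_half_le _ (fun i => (`|x i.*2| + `|x i.*2.+1|) ^+ 2) n _)).
    by move=> i; exact: sqr_ge0.
  apply: (@le_trans _ _ (4 * \sum_(k < n.*2) x k ^+ 2)); last first.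
    by rewrite ler_pM2l //; exact: ell2_sum_le.
  rewrite (sum_pairs (fun k => x k ^+ 2)) !mulr_sumr; apply: ler_sum => i _.
  rewrite -(real_normK (num_real (x i.*2))) -(real_normK (num_real (x i.*2.+1))).
  by have := sqr_ge0 (`|x i.*2| - `|x i.*2.+1|); nra.
by have [] := @ell2_of_bound _ (fun k => `|x k./2.*2| + `|x k./2.*2.+1|) _ h.
Qed.

Variables (omega b : nat -> R) (kap tau : R).
Hypothesis tau0 : 0 < tau.
Hypothesis kap0 : 0 < kap.
Hypothesis kap_omega : forall n, (0 < n)%N -> 2 * kap <= omega n.
Let mu := freq omega kap.
Let A := Ablock omega kap.

Lemma semigroup_ell2 (t : R) (x : nat -> R) : 0 <= t <= tau -> ell2 x ->
  ell2 (semigroup A t x).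
Proof.
move=> tt ex; apply: (@ell2_le _ _ _ (2 + tau)) (ell2_pairs ex) => k.
rewrite /semigroup blockdiagE [X in _ <= _ * X]ger0_norm; last exact: addr_ge0.
apply: (le_trans (ler_normD _ _)); rewrite mulrDr !normrM.
by apply: lerD; apply: ler_wpM2r => //; apply: expmx_Ablock_bound => // n0;
   exact: kap_omega.
Qed.

(** The entry of the input vector in the block of [k], attached to both coordinates
    of that block. *)
Definition input_weight (k : nat) : R := if (k./2 == 0)%N then 1 else b k./2.

Definition even_gain (n : nat) : R := if (n == 0)%N then tau else omega n / mu n.
Definition odd_gain (n : nat) : R := if (n == 0)%N then 0 else kap / mu n.

(** The change of coordinates, block by block, from the pure oscillations to the
    second column of the exponential of the block.  The index [k.-1] is the even
    index of the block of an odd [k]. *)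
Definition coords_of_moments (m : nat -> R) (k : nat) : R :=
  if odd k then m k - odd_gain k./2 * m k.-1 else even_gain k./2 * m k.

Lemma expmx_column (k : nat) (t : R) : 0 <= t ->
  expmx (t *: A k./2) (inord (odd k)) 1 =
  coords_of_moments (fun j => test_mode tau kap mu j t) k.
Proof.
move=> t0; have tn0 : tau != 0 by exact: lt0r_neq0.
have i0 : inord 0 = 0 :> 'I_2 by apply/val_inj; rewrite /= inordK.
have i1 : inord 1 = 1 :> 'I_2 by apply/val_inj; rewrite /= inordK.
have k1 : odd k -> k.-1./2 = k./2 /\ odd k.-1 = false.
  by case: k => // k /= /negbTE ok; rewrite uphalf_half ok.
case: (posnP k./2) => [k0|k0].
  have [e00 e01 e10 e11] := mx2E 1 t 0 (1 : R).
  rewrite k0 /A expmx_Ablock0 // /coords_of_moments /even_gain /odd_gain /test_mode k0 /=.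
  case ok: (odd k); first by rewrite i1 e11 mul0r subr0.
  by rewrite i0 e01 mulrC divfK.
have kw := kap_omega k0.
have wk : 0 <= kap < omega k./2 by have := kap0; lra.
have m0 : 0 < mu k./2 by exact: freq_gt0.
rewrite /A expmx_AblockS // -/mu.
have kz : (k./2 == 0)%N = false by apply/negbTE; rewrite -lt0n.
rewrite /coords_of_moments /even_gain /odd_gain /test_mode /osc_mode kz mxE.
case: ifP => ok.
  have [-> ok1] := k1 ok.
  rewrite kz /phase ok ok1 addr0 cosBpihalf i1.
  by have [_ _ _ ->] := mx2E (cos (mu k./2 * t) + kap / mu k./2 * sin (mu k./2 * t))
    (omega k./2 / mu k./2 * sin (mu k./2 * t))
    (- (omega k./2 / mu k./2 * sin (mu k./2 * t)))
    (cos (mu k./2 * t) - kap / mu k./2 * sin (mu k./2 * t)); ring.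
rewrite /phase ok cosBpihalf i0.
by have [_ -> _ _] := mx2E (cos (mu k./2 * t) + kap / mu k./2 * sin (mu k./2 * t))
    (omega k./2 / mu k./2 * sin (mu k./2 * t))
    (- (omega k./2 / mu k./2 * sin (mu k./2 * t)))
    (cos (mu k./2 * t) - kap / mu k./2 * sin (mu k./2 * t)); ring.
Qed.

Lemma semigroup_input (t u : R) (k : nat) : 0 <= t ->
  semigroup A t (fun k => Bvec b k * u) k =
  input_weight k * coords_of_moments (fun j => test_mode tau kap mu j t) k * u.
Proof.
move=> t0; rewrite /semigroup blockdiagE /Bvec /= odd_double /= mul0r mulr0 add0r.
rewrite uphalf_double expmx_column // /input_weight.
by rewrite mulrCA mulrA.
Qed.

Lemma coords_test_mode_bound k (t : R) : 0 <= t <= tau ->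
  `|coords_of_moments (fun j => test_mode tau kap mu j t) k| <= 2 + tau.
Proof.
move=> tt; have /andP[t0 _] := tt; rewrite -expmx_column //.
by apply: expmx_Ablock_bound => // n0; exact: kap_omega.
Qed.

Lemma gain_bound n : 0 <= odd_gain n <= 1 /\ 0 < even_gain n <= 2 + tau.
Proof.
rewrite /odd_gain /even_gain; case: (posnP n) => [_ /=|n0 /=].
  by rewrite lexx ler01 tau0 lerDr ler0n.
have kw := kap_omega n0; have k0 := kap0; have t0 := tau0.
have mw : omega n / 2 <= mu n by exact: freq_ge.
have m0 : 0 < mu n by lra.
have m1 : 0 < (mu n)^-1 by rewrite invr_gt0.
have -> : 0 <= kap / mu n by apply: divr_ge0; exact: ltW.
have -> : 0 < omega n / mu n by apply: divr_gt0 => //; lra.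
by rewrite /= !ler_pdivrMr //; split; nra.
Qed.

Lemma coords_of_moments_bound (m : nat -> R) (D : R) k :
  0 <= D -> (forall j, `|m j| <= D) ->
  `|coords_of_moments m k| <= (2 + tau) * D.
Proof.
move=> D0 mD; have [] := gain_bound k./2; move=> /andP[q0 q1] /andP[e0 e1].
rewrite /coords_of_moments; case: odd; last first.
  by rewrite normrM ler_pM // (ger0_norm (ltW e0)).
apply: (le_trans (ler_normB _ _)); rewrite normrM (ger0_norm q0).
have t0 := tau0; have := mD k; have := mD k.-1; have := normr_ge0 (m k.-1).
move: (odd_gain _) q0 q1 => q q0 q1 x y z.
have : q * `|m k.-1| <= D by nra.
nra.
Qed.

(** The inverse of the triangular change of coordinates [coords_of_moments]. *)
Definition moments_of_coords (z : nat -> R) (k : nat) : R :=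
  let s := z k./2.*2 / even_gain k./2 in
  if odd k then z k + odd_gain k./2 * s else s.

Lemma moments_of_coordsK (z : nat -> R) k :
  coords_of_moments (moments_of_coords z) k = z k.
Proof.
have [_] := gain_bound k./2; move=> /andP[e0 _].
rewrite /coords_of_moments /moments_of_coords.
case ok: (odd k).
  case: k e0 ok => // k e0 /= /negbTE ok; rewrite ok uphalf_half ok add0n.
  by rewrite addrK.
have kk : k./2.*2 = k by rewrite -[RHS]odd_double_half ok.
by rewrite kk mulrC divfK // lt0r_neq0.
Qed.


Hypothesis b_neq0 : forall n, (0 < n)%N -> b n != 0.
Hypothesis ell2_input : ell2 (input_weight).
Hypothesis gram_small : forall M,
  \sum_(k < M) \sum_(j < M) gram_error tau kap mu k j ^+ 2 <= 1 / 4.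

(** Solves a section of the Gram system.  The bound also covers the moments beyond
    the section; it is what controls the coordinates that are not prescribed. *)
Lemma moment_control (c : nat -> R) N : exists v : R -> R, [/\ continuous v,
  forall k, (k < N)%N -> revint tau (fun t => test_mode tau kap mu k t * v t) = c k &
  forall k, `|revint tau (fun t => test_mode tau kap mu k t * v t)| <=
     1 + \sum_(j < N) c j ^+ 2].
Proof.
have [a [aE aB]] := near_identity_solve c N gram_small.
pose F j t := a j * dual_mode tau kap mu j t.
have cF j : continuous (F j).
  by move=> t; apply: cvgMr; exact: continuous_dual_mode.
pose v t := \sum_(j < N) F j t.
have mE k : revint tau (fun t => test_mode tau kap mu k t * v t) =
    (if (k < N)%N then a k else 0) + \sum_(j < N) gram_error tau kap mu k j * a j.
  have cTD j : continuous (fun t => test_mode tau kap mu k t * dual_mode tau kap mu j t).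
    by move=> t; apply: cvgM; [exact: continuous_test_mode|exact: continuous_dual_mode].
  have cG j : continuous (fun t => a j * (test_mode tau kap mu k t * dual_mode tau kap mu j t)).
    by move=> t; apply: cvgMr; exact: cTD.
  rewrite (_ : (fun t => _) = fun t =>
      \sum_(j < N) a j * (test_mode tau kap mu k t * dual_mode tau kap mu j t)); last first.
    by apply/funext => t; rewrite mulr_sumr; apply: eq_bigr => j _; rewrite mulrCA.
  rewrite (@revint_sum _ tau N _ cG).2.
  rewrite (eq_bigr (fun j : 'I_N => (k == j)%:R * a j +
     gram_error tau kap mu k j * a j)); last first.
    by move=> j _; rewrite revintZ // /gram_error; ring.
  rewrite big_split /=; congr (_ + _); case: ifP => kN.
    rewrite (bigD1 (Ordinal kN)) //= eqxx mul1r big1 ?addr0 // => j.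
    rewrite -val_eqE eq_sym /= => /negbTE ->; exact: mul0r.
  rewrite big1 // => j _; case: eqP => [kj|_]; last exact: mul0r.
  by rewrite kj ltn_ord in kN.
exists v; split.
- exact: (@revint_sum _ tau N _ cF).1.
- by move=> k kN; rewrite mE kN aE.
move=> k; rewrite mE.
have le1 (x D : R) : x ^+ 2 <= D -> `|x| <= 1 + D.
  by rewrite -(real_normK (num_real x)); have := normr_ge0 x; nra.
apply: le1; case: ifP => kN; last by rewrite add0r.
rewrite aE // (bigD1 (Ordinal kN)) //= lerDl.
by apply: sumr_ge0 => j _; exact: sqr_ge0.
Qed.

Lemma L2_control (v : R -> R) : continuous v -> L2 tau (fun s => v (tau - s)).
Proof.
move=> cv; split.
  have /(measurable_int _) := revint_integrable tau cv.
  by move=> /measurable_EFinP.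
have cv2 : continuous (fun t => v t ^+ 2).
  by move=> t; apply: cvgM; exact: cv.
have := revint_integrable tau cv2 => /integrableP[_].
apply: le_lt_trans; rewrite le_eqVlt; apply/orP; left; apply/eqP.
by apply: eq_integral => s _ /=; rewrite ger0_norm ?sqr_ge0.
Qed.

Lemma continuous_bounded_itv (v : R -> R) : continuous v ->
  exists2 V : R, 0 <= V & forall t, 0 <= t <= tau -> `|v t| <= V.
Proof.
move=> cv.
have cn : {within `[0, tau], continuous (fun t => `|v t|)}.
  apply: continuous_subspaceT => t; apply: cvg_norm; exact: cv.
have [c _ hc] := EVT_max (ltW tau0) cn.
by exists `|v c| => // t tt; apply: hc; rewrite in_itv.
Qed.

Lemma continuous_coords_test_mode k :
  continuous (fun t => coords_of_moments (fun j => test_mode tau kap mu j t) k).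
Proof.
rewrite /coords_of_moments; case: odd => t.
  by apply: cvgB; [|apply: cvgMr]; exact: continuous_test_mode.
by apply: cvgMr; exact: continuous_test_mode.
Qed.

(** The integrand at time [s] is the function [phi k] at [tau - s], dominated by
    the square-summable input weights. *)
Lemma mild_solution_of_control (x0 : nat -> R) (v : R -> R) : continuous v ->
  let m k := revint tau (fun t => test_mode tau kap mu k t * v t) in
  let J k := input_weight k * coords_of_moments m k in
  ell2 J /\ is_mild_solution_at A (Bvec b) x0 (fun s => v (tau - s)) tau
    (fun k => semigroup A tau x0 k + J k).
Proof.
move=> cv m J.
pose phi k t := input_weight k * coords_of_moments (fun j => test_mode tau kap mu j t) k * v t.
have cphi k : continuous (phi k).
  move=> t; apply: cvgM; last exact: cv.
  by apply: cvgMr; exact: continuous_coords_test_mode.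
have [V V0 vV] := continuous_bounded_itv cv.
have JE k : revint tau (phi k) = J k.
  have cT j : continuous (fun t => test_mode tau kap mu j t * v t).
    by move=> t; apply: cvgM; [exact: continuous_test_mode|exact: cv].
  have cZ (d : R) j : continuous (fun t => d * (test_mode tau kap mu j t * v t)).
    by move=> t; apply: cvgMr; exact: cT.
  rewrite /J /phi /coords_of_moments /m; case: odd.
    rewrite mulrBr mulrA -mulNr -!revintZ // -revintD //.
    by congr revint; apply/funext => t; ring.
  rewrite mulrA -revintZ //; congr revint; apply/funext => t; ring.
have := @is_ell2_integral_revint R tau ((2 + tau) * V)
   (fun s => semigroup A (tau - s) (fun k => Bvec b k * v (tau - s))) phi
   input_weight tau0 cphi.
rewrite (_ : (fun k => revint tau (phi k)) = J); last exact/funext.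
case.
- move=> k t tt; rewrite /phi !normrM [leRHS]mulrC -mulrA.
  apply: ler_wpM2l => //; apply: ler_pM => //; last exact: vV.
  exact: coords_test_mode_bound.
- exact: ell2_input.
- move=> s /andP[s0 st] k; rewrite semigroup_input //; lra.
move=> h1 h2 h3; split=> //.
by exists J; split.
Qed.

(** The target is truncated first, at [M0] blocks; this fixes the data of the moment
    problem, hence the bound [K] on the coordinates that are not prescribed.  Only
    then is the number [N] of prescribed blocks chosen, so large that [K] times the
    tail of the input weights is negligible. *)
Lemma approx_controllable_of_gram : approx_controllable A (Bvec b) tau.
Proof.
move=> x0 x1 ex0 ex1 eps eps0.
pose z k := x1 k - semigroup A tau x0 k.
have tt : 0 <= tau <= tau by rewrite lexx ltW.
have ez : ell2 z.
  apply: ell2D => //; apply: (@ell2_le _ _ _ 1) (semigroup_ell2 tt ex0) => k.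
  by rewrite normrN mul1r.
have e8 : 0 < eps ^+ 2 / 8 by rewrite divr_gt0 // exprn_gt0.
have [M0 hM0] := ell2_tail ez e8.
pose zc k := if (k < M0.*2)%N then z k else 0.
pose c := moments_of_coords (fun k => zc k / input_weight k).
pose D := 1 + \sum_(j < M0.*2) c j ^+ 2.
have D1 : 1 <= D by rewrite lerDl; apply: sumr_ge0 => j _; exact: sqr_ge0.
pose K := (2 + tau) * D.
have K0 : 0 <= K by rewrite mulr_ge0 //; [have := tau0; lra|lra].
have e8K : 0 < eps ^+ 2 / 8 / (K ^+ 2 + 1).
  by rewrite divr_gt0 // ltr_wpDl // sqr_ge0.
have [N1 hN1] := ell2_tail ell2_input e8K.
pose N := maxn M0 N1.
have c0 k : (M0.*2 <= k)%N -> c k = 0.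
  move=> Mk; have Mk' : (M0.*2 <= k./2.*2)%N.
    by rewrite leq_double -[M0]doubleK half_leq.
  rewrite /c /moments_of_coords /zc !ltnNge Mk Mk' /= !mul0r mulr0 addr0.
  by case: odd.
have [v [cv vc vb]] := moment_control c N.*2.
have sumD : 1 + \sum_(j < N.*2) c j ^+ 2 = D.
  rewrite /D -(big_mkord xpredT (fun j => c j ^+ 2)).
  rewrite -(big_mkord xpredT (fun j => c j ^+ 2)).
  have MN : (M0.*2 <= N.*2)%N by rewrite leq_double leq_maxl.
  rewrite (big_cat_nat (leq0n _) MN) /=.
  suff -> : \sum_(M0.*2 <= j < N.*2) c j ^+ 2 = 0 by rewrite addr0.
  rewrite big_nat_cond big1 // => j /andP[/andP[Mj _] _].
  by rewrite c0 // expr0n.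
have [] := mild_solution_of_control x0 cv.
set m := fun k => revint tau _; set J := fun k => _ => eJ mild.
exists (fun s => v (tau - s)); split; first exact: L2_control.
exists (fun k => semigroup A tau x0 k + J k); split => //.
  by apply: ell2D => //; exact: semigroup_ell2.
have w0 k : input_weight k != 0.
  rewrite /input_weight; case: (posnP k./2) => [_|k0] /=; first exact: oner_neq0.
  exact: b_neq0.
have Jlow k : (k < N.*2)%N -> J k = zc k.
  move=> kN; rewrite /J.
  have -> : coords_of_moments m k = coords_of_moments c k.
    rewrite /coords_of_moments /m vc //; case: odd => //.
    by rewrite vc // (leq_ltn_trans (leq_pred k)).
  by rewrite /c moments_of_coordsK mulrC divfK.
have Jhigh k : `|J k| <= K * `|input_weight k|.
  rewrite /J normrM mulrC ler_wpM2r // /K.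
  apply: coords_of_moments_bound; first lra.
  by move=> j; rewrite -sumD; exact: vb.
have err k : semigroup A tau x0 k + J k - x1 k = J k - z k by rewrite /z; ring.
(* Below [N] the only error is the truncation of [z]; the indices run over
   coordinates, two per block, so [M0.*2 <= k] implies [M0 <= k]. *)
have errb k : (J k - z k) ^+ 2 <=
    2 * (if (M0 <= k)%N then z k ^+ 2 else 0) +
    2 * K ^+ 2 * (if (N1 <= k)%N then input_weight k ^+ 2 else 0).
  have K2 : 0 <= 2 * K ^+ 2 * (if (N1 <= k)%N then input_weight k ^+ 2 else 0).
    by apply: mulr_ge0; [rewrite mulr_ge0 ?sqr_ge0|case: ifP => // _; exact: sqr_ge0].
  have [kN|Nk] := ltnP k N.*2.
    rewrite (Jlow k kN) /zc; case: ltnP => kM.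
      rewrite subrr expr0n /=; apply: addr_ge0 => //; apply: mulr_ge0 => //.
      by case: ifP => // _; exact: sqr_ge0.
    have -> : (M0 <= k)%N by apply: leq_trans kM; rewrite -addnn leq_addr.
    by rewrite sub0r sqrrN; have := sqr_ge0 (z k); lra.
  have Nk' : (N <= k)%N by apply: leq_trans Nk; rewrite -addnn leq_addr.
  rewrite (leq_trans (leq_maxl _ _) Nk') (leq_trans (leq_maxr _ _) Nk').
  have J2 : J k ^+ 2 <= K ^+ 2 * input_weight k ^+ 2.
    rewrite -(real_normK (num_real (J k))) -(real_normK (num_real (input_weight k))).
    rewrite -exprMn; apply: lerXn2r => //; rewrite nnegrE //; exact: mulr_ge0.
  have := sqr_ge0 (J k + z k); lra.
apply: ell2_norm_lt => //.
under [fun k => _]eq_fun do rewrite err.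
(* The two tails contribute [2 * eps ^ 2 / 8] each. *)
have hb n : \sum_(k < n) (J k - z k) ^+ 2 <= eps ^+ 2 / 2.
  apply: (le_trans (ler_sum _ (fun (k : 'I_n) _ => errb k))).
  rewrite big_split /= -!mulr_sumr -!big_mkcond /=.
  have h1 := hM0 M0 n (leqnn _).
  have h2 := hN1 N1 n (leqnn _).
  have KK : 0 < K ^+ 2 + 1 by rewrite ltr_wpDl // sqr_ge0.
  have h3 : K ^+ 2 * \sum_(k < n | (N1 <= k)%N) input_weight k ^+ 2 <= eps ^+ 2 / 8.
    apply: (@le_trans _ _ ((K ^+ 2 + 1) * \sum_(k < n | (N1 <= k)%N) input_weight k ^+ 2)).
      apply: ler_wpM2r; last by rewrite lerDl.
      by apply: sumr_ge0 => k _; exact: sqr_ge0.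
    by rewrite mulrC -ler_pdivlMr.
  lra.
have [_ h] := @ell2_of_bound _ (fun k => J k - z k) _ hb.
apply: (le_lt_trans h); lra.
Qed.

End Controllability.

(** * Conclusion *)

(** The sum of [b_n ^ 2] starts at [n = 1]; the zeroth block adds the weight [1]. *)
Lemma input_weight_ell2 (R : realType) (b : nat -> R) :
  cvgn (series (fun n => b n.+1 ^+ 2)) -> ell2 (input_weight b).
Proof.
move=> hb.
pose F i : R := if (i == 0)%N then 1 else b i ^+ 2.
have F0 i : 0 <= F i by rewrite /F; case: ifP => // _; exact: sqr_ge0.
have h n : \sum_(k < n) input_weight b k ^+ 2 <=
    2 * (1 + limn (series (fun n => b n.+1 ^+ 2))).
  rewrite (eq_bigr (fun k : 'I_n => F k./2)); last first.
    by move=> k _; rewrite /input_weight /F; case: ifP => _; rewrite ?expr1n.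
  apply: (le_trans (sum_half_le n F0)); rewrite ler_pM2l //.
  case: n => [|n].
    rewrite big_ord0; have := ell2_sum_le 0 hb; rewrite big_ord0; lra.
  by rewrite big_ord_recl; apply: lerD => //; exact: ell2_sum_le n hb.
by have [] := ell2_of_bound h.
Qed.

Theorem proposition2 (R : realType) (omega b : nat -> R)
  (hb_sum : cvgn (series (fun n => b n.+1 ^+ 2)))
  (hb : forall n, (0 < n)%N -> b n != 0)
  (homega_pos : forall n, (0 < n)%N -> 0 < omega n)
  (homega_inj : forall i j, (0 < i)%N -> (0 < j)%N -> i != j ->
    omega i != omega j)
  (homega_sum : (\esum_(p in [set p : nat * nat |
      [/\ (0 < p.1)%N, (0 < p.2)%N & p.1 != p.2]])
      (1 / (omega p.1 - omega p.2) ^+ 2)%:E < +oo)%E) :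
  exists tau : R, 0 < tau /\
    exists kappa0 : R, 0 < kappa0 /\
      forall kappa : R, 0 < kappa -> kappa < kappa0 ->
        approx_controllable (Ablock omega kappa) (Bvec b) tau.
Proof.
have [W W0 hW] := weight_sums_bounded homega_pos homega_inj homega_sum.
have [m m0 hm] := frequencies_lower_bound homega_pos homega_inj homega_sum.
(* Each block meets two rows and two columns of the Gram matrix, so the squared
   Hilbert-Schmidt norm is at most [4 W (108 / tau) ^ 2], and [432 = 4 * 108]
   brings it below [1 / 4]. *)
pose tau := 432 * (W + 1).
have tau0 : 0 < tau by rewrite /tau; lra.
exists tau; split=> //.
have k0 : 0 < Num.min (m / 2) (1 / 2 / tau).
  by rewrite lt_min; apply/andP; split; rewrite !divr_gt0.
exists (Num.min (m / 2) (1 / 2 / tau)); split=> // kappa kap0.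
rewrite lt_min => /andP[km]; rewrite ltr_pdivlMr // => /ltW kt.
have kw n : (0 < n)%N -> 2 * kappa <= omega n by move=> /hm; lra.
have kw' n : (0 < n)%N -> 0 <= kappa < omega n by move=> /hm; lra.
apply: approx_controllable_of_gram => //; first exact: input_weight_ell2.
move=> M.
have gap n p : (0 < n)%N -> (0 < p)%N -> n != p ->
    0 < `|omega n - omega p| <= `|freq omega kappa n - freq omega kappa p|.
  move=> n0 p0 np; rewrite normr_gt0 subr_eq0 homega_inj //=.
  by apply: freq_gap; exact: kw'.
apply: (@le_trans _ _ (\sum_(k < M) \sum_(j < M)
  (108 / tau) ^+ 2 * sqr_gap_weight omega k./2 j./2)).
  apply: ler_sum => k _; apply: ler_sum => j _; apply: gram_error_le => //; first exact: ltW.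
  by move=> n n0; apply: freq_ge => //; exact: kw.
have w0 := sqr_gap_weight_ge0 omega.
under eq_bigr do rewrite -mulr_sumr.
rewrite -mulr_sumr.
apply: (@le_trans _ _ ((108 / tau) ^+ 2 * (4 * W))).
  apply: ler_wpM2l; first exact: sqr_ge0.
  apply: (@le_trans _ _ (\sum_(k < M) 2 * \sum_(j < M) sqr_gap_weight omega k./2 j)).
    by apply: ler_sum => k _; exact: (@sum_half_le _ (sqr_gap_weight omega k./2) M).
  rewrite (_ : 4 * W = 2 * (2 * W)); last by ring.
  rewrite -mulr_sumr ler_pM2l //.
  apply: (le_trans (@sum_half_le _ (fun i => \sum_(j < M) sqr_gap_weight omega i j) M _)).
    by move=> i; apply: sumr_ge0.
  by rewrite ler_pM2l.
rewrite expr_div_n mulrAC ler_pdivrMr ?exprn_gt0 // /tau; nra.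
Qed.
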